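(* $\mathcal{V}_{ac}$ is the unique limit subvariety of $\mathbf{NF}_3$.
   Context: An additively idempotent semiring (ai-semiring) is an algebra $(S,+,\cdot)$ with two binary operations such that $(S,+)$ is a commutative idempotent semigroup, $(S,\cdot)$ is a semigroup, and both distributive laws $(x+y)z=xz+yz$, $x(y+z)=xy+xz$ hold. A flat semiring is an ai-semiring $S$ whose multiplicative reduct has a zero element $0$ and in which $a+b=0$ for all distinct $a,b\in S$. It is $3$-nilpotent if $a_1a_2a_3=0$ for all $a_1,a_2,a_3\in S$. $\mathbf{NF}_3$ is the variety (in the signature $(+,\cdot)$) generated by all $3$-nilpotent flat semirings. Graphs are directed (loops allowed, possibly empty, possibly infinite), contain no isolated vertices, and every vertex has out-degree at most $1$ and in-degree at most $1$. For such a graph $\mathbb G$, the graph semiring $S_{\mathbb G}$ is the flat semiring on the disjoint union of $V(\mathbb G)$ and $\{0,\omega\}$, with $x\cdot y=\omega$ if $x,y\in V(\mathbb G)$ and $(x,y)\in E(\mathbb G)$, $x\cdot y=0$ otherwise, and $x+x=x$, $x+y=0$ for $x\ne y$. The graph semiring $S_{\mathbb G}$ is acyclic if $\mathbb G$ contains no (directed) cycles, loops being cycles of length $1$. $\mathcal{V}_{ac}$ is the subvariety of $\mathbf{NF}_3$ generated by all acyclic graph semirings. A variety is finitely based if it can be defined by finitely many identities, and nonfinitely based otherwise. A limit variety is a minimal nonfinitely based variety: it is nonfinitely based but all of its proper subvarieties are finitely based. *)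

(* Defs.v *)
From Stdlib Require Import List ClassicalEpsilon.

Set Implicit Arguments.

(** * Algebras, terms and identities in the signature (+, ·) *)

Record algebra : Type := Algebra {
  carrier :> Type;
  add : carrier -> carrier -> carrier;
  mul : carrier -> carrier -> carrier;
  carrier_inhabited : inhabited carrier
}.

Declare Scope alg_scope.
Delimit Scope alg_scope with alg.
Notation "x ⊕ y" := (add _ x y) (at level 50, left associativity) : alg_scope.
Notation "x ⊙ y" := (mul _ x y) (at level 40, left associativity) : alg_scope.
Local Open Scope alg_scope.

Inductive term : Type :=
| Var : nat -> term
| Add : term -> term -> term
| Mul : term -> term -> term.

Fixpoint eval (A : algebra) (s : nat -> A) (t : term) : A :=
  match t with
  | Var n => s n
  | Add t1 t2 => eval A s t1 ⊕ eval A s t2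
  | Mul t1 t2 => eval A s t1 ⊙ eval A s t2
  end.

Definition identity : Type := (term * term)%type.

Definition satisfies (A : algebra) (e : identity) : Prop :=
  forall s : nat -> A, eval A s (fst e) = eval A s (snd e).

(** * Varieties *)

Definition is_hom (A B : algebra) (f : A -> B) : Prop :=
  (forall x y : A, f (x ⊕ y) = f x ⊕ f y) /\
  (forall x y : A, f (x ⊙ y) = f x ⊙ f y).

Definition prod_algebra (I : Type) (A : I -> algebra) : algebra :=
  @Algebra (forall i, A i)
    (fun x y i => x i ⊕ y i)
    (fun x y i => x i ⊙ y i)
    (inhabits (fun i => epsilon (carrier_inhabited (A i)) (fun _ => True))).

(** Subalgebras are taken up to isomorphism, that is, as the algebras that
    embed. *)
Definition is_variety (V : algebra -> Prop) : Prop :=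
  (forall (A B : algebra) (f : A -> B),
     is_hom A B f -> (forall b, exists a, f a = b) -> V A -> V B) /\
  (forall (A B : algebra) (f : A -> B),
     is_hom A B f -> (forall x y, f x = f y -> x = y) -> V B -> V A) /\
  (forall (I : Type) (A : I -> algebra),
     (forall i, V (A i)) -> V (prod_algebra A)).

Definition subclass (V W : algebra -> Prop) : Prop := forall A, V A -> W A.

Definition same_class (V W : algebra -> Prop) : Prop := forall A, V A <-> W A.

Definition variety_generated (K : algebra -> Prop) : algebra -> Prop :=
  fun A => forall V, is_variety V -> subclass K V -> V A.

Definition finitely_based (V : algebra -> Prop) : Prop :=
  exists E : list identity,
    forall A, V A <-> (forall e, In e E -> satisfies A e).

Definition limit_variety (V : algebra -> Prop) : Prop :=
  is_variety V /\
  ~ finitely_based V /\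
  (forall W, is_variety W -> subclass W V -> ~ same_class W V ->
     finitely_based W).

(** * Flat semirings and NF3 *)

Definition ai_semiring (A : algebra) : Prop :=
  (forall x y z : A, (x ⊕ y) ⊕ z = x ⊕ (y ⊕ z)) /\
  (forall x y : A, x ⊕ y = y ⊕ x) /\
  (forall x : A, x ⊕ x = x) /\
  (forall x y z : A, (x ⊙ y) ⊙ z = x ⊙ (y ⊙ z)) /\
  (forall x y z : A, (x ⊕ y) ⊙ z = (x ⊙ z) ⊕ (y ⊙ z)) /\
  (forall x y z : A, x ⊙ (y ⊕ z) = (x ⊙ y) ⊕ (x ⊙ z)).

(** The zero is not part of the signature; it is unique when it exists. *)
Definition flat_semiring_with_zero (A : algebra) (o : A) : Prop :=
  ai_semiring A /\
  (forall a : A, o ⊙ a = o /\ a ⊙ o = o) /\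
  (forall a b : A, a <> b -> a ⊕ b = o).

Definition nil3_flat_semiring (A : algebra) : Prop :=
  exists o : A,
    flat_semiring_with_zero A o /\ (forall a b c : A, a ⊙ b ⊙ c = o).

Definition NF3 : algebra -> Prop := variety_generated nil3_flat_semiring.

(** * Graph semirings *)

Record graph : Type := Graph {
  vertex : Type;
  edge : vertex -> vertex -> Prop;
  no_isolated : forall x, exists y, edge x y \/ edge y x;
  out_degree_le1 : forall x y z, edge x y -> edge x z -> y = z;
  in_degree_le1 : forall x y z, edge y x -> edge z x -> y = z
}.

(** A directed cycle [c 0 -> c 1 -> ... -> c (n-1) -> c 0] of length [n] on
    distinct vertices; the values of [c] from [n] on are irrelevant. *)
Definition directed_cycle (G : graph) (n : nat) (c : nat -> vertex G) : Prop :=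
  0 < n /\
  (forall i j, i < n -> j < n -> c i = c j -> i = j) /\
  (forall i, S i < n -> edge G (c i) (c (S i))) /\
  edge G (c (n - 1)) (c 0).

Definition acyclic (G : graph) : Prop :=
  forall n (c : nat -> vertex G), ~ directed_cycle G n c.

Inductive gs_elt (G : graph) : Type :=
| gs_vertex : vertex G -> gs_elt G
| gs_zero : gs_elt G
| gs_omega : gs_elt G.

Arguments gs_vertex {G} _.
Arguments gs_zero {G}.
Arguments gs_omega {G}.

Definition gs_add (G : graph) (x y : gs_elt G) : gs_elt G :=
  if excluded_middle_informative (x = y) then x else gs_zero.

Definition gs_mul (G : graph) (x y : gs_elt G) : gs_elt G :=
  match x, y with
  | gs_vertex u, gs_vertex v =>
      if excluded_middle_informative (edge G u v) then gs_omega else gs_zero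
  | _, _ => gs_zero
  end.

Definition graph_semiring (G : graph) : algebra :=
  @Algebra (gs_elt G) (@gs_add G) (@gs_mul G) (inhabits gs_zero).

Definition acyclic_graph_semiring (A : algebra) : Prop :=
  exists G : graph, acyclic G /\ A = graph_semiring G.

(** Graph semirings are 3-nilpotent flat, so this is also the smallest
    subvariety of [NF3] containing the acyclic ones. *)
Definition V_ac : algebra -> Prop := variety_generated acyclic_graph_semiring.

(* Main.v *)
From Stdlib Require Import List Arith Lia Factorial FinFun ClassicalEpsilon.
From Stdlib Require Import FunctionalExtensionality PropExtensionality.
Require Import Defs.
Import ListNotations.
Local Open Scope alg_scope.

(** The variety [NF3] is axiomatised by finitely many identities, and its
    members are controlled by graph semirings: if [a] is not below [b] in the
    semilattice order, then collapsing the ideal below [b] to [omega], and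
    identifying elements that have the same products in that ideal, is a
    homomorphism onto a graph semiring that separates [a] from [b]
    ([satisfies_of_graph_quotients]).  So an identity may be tested on the graph
    semirings that are quotients of an algebra.  In a 3-nilpotent algebra a term
    is a sum of words of length one or two, or top, and an identity is a
    conjunction of entailments, [q <= sum of l], between a finite set [l] of
    words and a word [q] ([satisfies_entails]).  In a graph semiring, words of
    length two prescribe edges, so an entailment says that a pattern of edges
    either cannot occur or forces one more edge.

    [V_ac] has no finite basis: a cycle of length [p] with a vertex removed is a
    path, so identities of [V_ac] with few variables hold in the semiring of
    that cycle, while the entailment that forbids closed walks of length [p]
    does not ([V_ac_not_finitely_based]).

    Everything else follows from the claim that a subvariety [W] of [NF3] that
    does not contain [V_ac] is finitely based
    ([finitely_based_of_not_above_V_ac]): proper subvarieties of [V_ac] are of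
    this kind, and a limit variety must contain [V_ac], hence equal it by
    minimality.  To prove the claim, note that a finite piece of an acyclic graph
    is a union of paths and is therefore an induced subgraph of every long enough
    path.  If graphs with [W (graph_semiring G)] had arbitrarily long paths, an
    identity failing in some acyclic graph semiring would fail in [W]; so the
    paths in these graphs have bounded length ([bounded_paths]).  Longer walks
    then run around short cycles, and for a suitable factorial [m] every walk of
    length [m] is closed, which is one entailment.  In a graph with this
    property the components are paths and cycles of boundedly many isomorphism
    types, and the graph can be folded onto one component of each type while a
    few chosen vertices stay fixed ([folding]).  Composing an assignment with
    such a folding turns a failure of an entailment of [W] into a failure of an
    entailment of [W] in a bounded number of variables.  Up to equivalence there
    are finitely many of those, and they form a basis. *)

(** * Varieties and their identities *)

Lemma eval_hom (A B : algebra) (f : A -> B) :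
  is_hom A B f ->
  forall s t, f (eval A s t) = eval B (fun n => f (s n)) t.
Proof.
  intros [Hadd Hmul] s t.
  induction t as [n | t IHt u IHu | t IHt u IHu]; simpl.
  - reflexivity.
  - now rewrite Hadd, IHt, IHu.
  - now rewrite Hmul, IHt, IHu.
Qed.

Lemma eval_prod (I : Type) (A : I -> algebra) s t i :
  eval (prod_algebra A) s t i = eval (A i) (fun n => s n i) t.
Proof.
  induction t as [n | t IHt u IHu | t IHt u IHu]; simpl.
  - reflexivity.
  - now rewrite IHt, IHu.
  - now rewrite IHt, IHu.
Qed.

Lemma satisfies_quotient (A B : algebra) (f : A -> B) e :
  is_hom A B f -> (forall b, exists a, f a = b) ->
  satisfies A e -> satisfies B e.
Proof.
  intros Hf Hsurj HA s.
  destruct (constructive_indefinite_description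
              (fun g : B -> A => forall b, f (g b) = b)) as [g Hg].
  { exists (fun b => proj1_sig (constructive_indefinite_description _ (Hsurj b))).
    intros b. now destruct (constructive_indefinite_description _ (Hsurj b)). }
  replace s with (fun n => f (g (s n)))
    by (apply functional_extensionality; intros; apply Hg).
  rewrite <- !(eval_hom A B f Hf (fun n => g (s n))).
  f_equal. apply HA.
Qed.

Lemma is_variety_models (E : identity -> Prop) :
  is_variety (fun A => forall e, E e -> satisfies A e).
Proof.
  split; [| split].
  - intros A B f Hf Hsurj HA e He.
    exact (satisfies_quotient A B f e Hf Hsurj (HA e He)).
  - intros A B f Hf Hinj HB e He s. apply Hinj.
    rewrite !(eval_hom A B f Hf). now apply HB.
  - intros I A HA e He s. extensionality i.
    rewrite !eval_prod. now apply HA.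
Qed.

Lemma is_variety_generated K : is_variety (variety_generated K).
Proof.
  split; [| split].
  - intros A B f Hf Hsurj HA V HV HK. exact (proj1 HV A B f Hf Hsurj (HA V HV HK)).
  - intros A B f Hf Hinj HB V HV HK.
    exact (proj1 (proj2 HV) A B f Hf Hinj (HB V HV HK)).
  - intros I A HA V HV HK.
    exact (proj2 (proj2 HV) I A (fun i => HA i V HV HK)).
Qed.

Lemma generated_contains K : subclass K (variety_generated K).
Proof. intros A HA V _ HK. now apply HK. Qed.

Lemma generated_satisfies K e :
  (forall A, K A -> satisfies A e) ->
  forall A, variety_generated K A -> satisfies A e.
Proof.
  intros HK A HA.
  refine (HA (fun B => forall e', e' = e -> satisfies B e') _ _ e eq_refl).
  - apply is_variety_models.
  - intros B HB e' ->. now apply HK.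
Qed.

(** Terms over an arbitrary set of variables: an algebra [A] is presented as a
    quotient of the terms over its own carrier, which may be uncountable. *)
Inductive xterm (X : Type) : Type :=
| xVar : X -> xterm X
| xAdd : xterm X -> xterm X -> xterm X
| xMul : xterm X -> xterm X -> xterm X.

Arguments xVar {X}.
Arguments xAdd {X}.
Arguments xMul {X}.

Fixpoint xeval (A : algebra) {X : Type} (f : X -> A) (t : xterm X) : A :=
  match t with
  | xVar x => f x
  | xAdd t u => xeval A f t ⊕ xeval A f u
  | xMul t u => xeval A f t ⊙ xeval A f u
  end.

Fixpoint xvars {X : Type} (t : xterm X) : list X :=
  match t with
  | xVar x => [x]
  | xAdd t u | xMul t u => xvars t ++ xvars u
  end.

Fixpoint number_vars {X : Type} (i : X -> nat) (t : xterm X) : term :=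
  match t with
  | xVar x => Var (i x)
  | xAdd t u => Add (number_vars i t) (number_vars i u)
  | xMul t u => Mul (number_vars i t) (number_vars i u)
  end.

Lemma eval_number_vars (A : algebra) X (i : X -> nat) s t :
  eval A s (number_vars i t) = xeval A (fun x => s (i x)) t.
Proof.
  induction t as [n | t IHt u IHu | t IHt u IHu]; simpl; congruence.
Qed.

Lemma xeval_ext (A : algebra) X (f g : X -> A) t :
  (forall x, In x (xvars t) -> f x = g x) -> xeval A f t = xeval A g t.
Proof.
  induction t as [n | t IHt u IHu | t IHt u IHu]; simpl; intros H.
  - apply H. now left.
  - rewrite IHt, IHu; auto using in_or_app.
  - rewrite IHt, IHu; auto using in_or_app.
Qed.

Lemma xeval_prod (I : Type) (A : I -> algebra) X (f : X -> prod_algebra A) t i :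
  xeval (prod_algebra A) f t i = xeval (A i) (fun x => f x i) t.
Proof.
  induction t as [n | t IHt u IHu | t IHt u IHu]; simpl; congruence.
Qed.

Definition valid (V : algebra -> Prop) (e : identity) : Prop :=
  forall A, V A -> satisfies A e.

(** Two terms over the carrier of [A] that agree throughout [V] involve
    finitely many variables, so their agreement is an honest identity once
    these variables are numbered. *)
Lemma valid_xeval V (A : algebra) (t u : xterm A) :
  (forall e, valid V e -> satisfies A e) ->
  (forall (B : algebra) (f : A -> B), V B -> xeval B f t = xeval B f u) ->
  xeval A (fun x => x) t = xeval A (fun x => x) u.
Proof.
  intros HA Htu.
  destruct (carrier_inhabited A) as [a0].
  set (l := xvars t ++ xvars u).
  set (i := fun x => epsilon (inhabits 0) (fun n => nth n l a0 = x)).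
  assert (Hi : forall x, In x l -> nth (i x) l a0 = x).
  { intros x Hx. destruct (In_nth l x a0 Hx) as (n & _ & Hn).
    apply (epsilon_spec (inhabits 0) (fun n => nth n l a0 = x)).
    now exists n. }
  assert (He : satisfies A (number_vars i t, number_vars i u)).
  { apply HA. intros B HB s. simpl. rewrite !eval_number_vars. now apply Htu. }
  specialize (He (fun n => nth n l a0)). simpl in He.
  rewrite !eval_number_vars in He.
  rewrite (xeval_ext A A (fun x => x) (fun x => nth (i x) l a0) t),
    (xeval_ext A A (fun x => x) (fun x => nth (i x) l a0) u); trivial;
    intros x Hx; symmetry; apply Hi, in_or_app; auto.
Qed.

(** Birkhoff's theorem.  Each pair of terms over [A] that [V] distinguishes is
    distinguished by one member of [V]; in the product of these members, the
    subalgebra generated by a copy of [A] is free for [V] and maps onto [A]. *)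
Theorem birkhoff V (A : algebra) :
  is_variety V -> (forall e, valid V e -> satisfies A e) -> V A.
Proof.
  intros (Hquot & Hsub & Hprod) HA.
  set (I := {p : xterm A * xterm A |
              exists (B : algebra) (f : A -> B), V B /\ xeval B f (fst p) <> xeval B f (snd p)}).
  assert (W : forall i : I, {B : algebra & {f : A -> B | V B /\
      xeval B f (fst (proj1_sig i)) <> xeval B f (snd (proj1_sig i))}}).
  { intros [p Hp]. simpl.
    destruct (constructive_indefinite_description _ Hp) as [B HB].
    destruct (constructive_indefinite_description _ HB) as [f Hf].
    now exists B, f. }
  set (P := prod_algebra (fun i => projT1 (W i))).
  assert (HP : V P) by (apply Hprod; intros i; apply (proj2_sig (projT2 (W i)))).
  set (g := (fun x i => proj1_sig (projT2 (W i)) x) : A -> P).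
  set (C := {y : P | exists t, xeval P g t = y}).
  set (addC := fun x y : C => exist (fun y => exists t, xeval P g t = y)
     (proj1_sig x ⊕ proj1_sig y)
     match proj2_sig x, proj2_sig y with
     | ex_intro _ t Ht, ex_intro _ u Hu =>
         ex_intro _ (xAdd t u) (f_equal2 (add P) Ht Hu)
     end).
  set (mulC := fun x y : C => exist (fun y => exists t, xeval P g t = y)
     (proj1_sig x ⊙ proj1_sig y)
     match proj2_sig x, proj2_sig y with
     | ex_intro _ t Ht, ex_intro _ u Hu =>
         ex_intro _ (xMul t u) (f_equal2 (mul P) Ht Hu)
     end).
  destruct (carrier_inhabited A) as [a0].
  set (F := @Algebra C addC mulC
              (inhabits (exist _ (g a0) (ex_intro _ (xVar a0) eq_refl)))).
  assert (HF : V F).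
  { apply (Hsub F P (fun x => proj1_sig x)); trivial.
    - now split.
    - intros [x Hx] [y Hy]. simpl. intros ->. f_equal.
      apply Classical_Prop.proof_irrelevance. }
  set (h := fun x : F => xeval A (fun a => a)
              (proj1_sig (constructive_indefinite_description _ (proj2_sig x)))).
  assert (Hh : forall (x : F) t, xeval P g t = proj1_sig x ->
                 h x = xeval A (fun a => a) t).
  { intros x t Ht. unfold h.
    destruct (constructive_indefinite_description _ (proj2_sig x)) as [u Hu].
    simpl. apply (valid_xeval V A u t HA).
    (* Otherwise the pair is one of the indices, and [g] separates it. *)
    intros B f HB. apply Classical_Prop.NNPP. intros Hne.
    set (i := exist _ (u, t) (ex_intro _ B (ex_intro _ f (conj HB Hne))) : I).
    apply (proj2 (proj2_sig (projT2 (W i)))).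
    assert (E : xeval P g u i = xeval P g t i) by congruence.
    unfold P in E. rewrite !xeval_prod in E. exact E. }
  apply (Hquot F A h); trivial.
  - split; intros x y;
      destruct (proj2_sig x) as [t Ht] eqn:Ex, (proj2_sig y) as [u Hu] eqn:Ey.
    + rewrite (Hh x t Ht), (Hh y u Hu), (Hh (x ⊕ y) (xAdd t u)); trivial.
      change (xeval P g t ⊕ xeval P g u = proj1_sig x ⊕ proj1_sig y).
      now rewrite Ht, Hu.
    + rewrite (Hh x t Ht), (Hh y u Hu), (Hh (x ⊙ y) (xMul t u)); trivial.
      change (xeval P g t ⊙ xeval P g u = proj1_sig x ⊙ proj1_sig y).
      now rewrite Ht, Hu.
  - intros a.
    exists (exist _ (g a) (ex_intro _ (xVar a) eq_refl)).
    now rewrite (Hh _ (xVar a)).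
Qed.

(** * A finite axiomatisation of NF3 *)

(** The last four laws are what cancellation becomes when it may only be said
    with inequalities [t + q = t]: if [x·y] and [x·z] have a common nonzero
    value then [y] and [z] are the same neighbour of [x], so every product
    with [y] may be traded for the one with [z]. *)
Record nf3_laws (A : algebra) : Prop := {
  add_assoc : forall x y z : A, (x ⊕ y) ⊕ z = x ⊕ (y ⊕ z);
  add_comm : forall x y : A, x ⊕ y = y ⊕ x;
  add_idem : forall x : A, x ⊕ x = x;
  mul_assoc : forall x y z : A, (x ⊙ y) ⊙ z = x ⊙ (y ⊙ z);
  mul_add_l : forall x y z : A, (x ⊕ y) ⊙ z = (x ⊙ z) ⊕ (y ⊙ z);
  mul_add_r : forall x y z : A, x ⊙ (y ⊕ z) = (x ⊙ y) ⊕ (x ⊙ z);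
  nilpotent3 : forall x y z u v w : A, x ⊙ y ⊙ z = u ⊙ v ⊙ w;
  cube_top : forall x y : A, x ⊕ y ⊙ y ⊙ y = y ⊙ y ⊙ y;
  not_left_factor : forall x y : A, x ⊕ x ⊙ y = x ⊙ x ⊙ x;
  not_right_factor : forall x y : A, x ⊕ y ⊙ x = x ⊙ x ⊙ x;
  cancel_rl : forall x y z w : A,
    x ⊙ y ⊕ x ⊙ z ⊕ y ⊙ w ⊕ z ⊙ w = x ⊙ y ⊕ x ⊙ z ⊕ y ⊙ w;
  cancel_rr : forall x y z w : A,
    x ⊙ y ⊕ x ⊙ z ⊕ w ⊙ y ⊕ w ⊙ z = x ⊙ y ⊕ x ⊙ z ⊕ w ⊙ y;
  cancel_ll : forall x y z w : A,
    y ⊙ x ⊕ z ⊙ x ⊕ y ⊙ w ⊕ z ⊙ w = y ⊙ x ⊕ z ⊙ x ⊕ y ⊙ w;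
  cancel_lr : forall x y z w : A,
    y ⊙ x ⊕ z ⊙ x ⊕ w ⊙ y ⊕ w ⊙ z = y ⊙ x ⊕ z ⊙ x ⊕ w ⊙ y
}.

Definition nf3_basis : list identity :=
  let x := Var 0 in let y := Var 1 in let z := Var 2 in
  let u := Var 3 in let v := Var 4 in let w := Var 5 in
  let cube t := Mul (Mul t t) t in
  let below q t := (Add t q, t) in
  [ (Add (Add x y) z, Add x (Add y z));
    (Add x y, Add y x);
    (Add x x, x);
    (Mul (Mul x y) z, Mul x (Mul y z));
    (Mul (Add x y) z, Add (Mul x z) (Mul y z));
    (Mul x (Add y z), Add (Mul x y) (Mul x z));
    (Mul (Mul x y) z, Mul (Mul u v) w);
    (Add x (cube y), cube y);
    (Add x (Mul x y), cube x);
    (Add x (Mul y x), cube x);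
    below (Mul z u) (Add (Add (Mul x y) (Mul x z)) (Mul y u));
    below (Mul u z) (Add (Add (Mul x y) (Mul x z)) (Mul u y));
    below (Mul z u) (Add (Add (Mul y x) (Mul z x)) (Mul y u));
    below (Mul u z) (Add (Add (Mul y x) (Mul z x)) (Mul u y)) ].

Lemma nf3_basis_correct (A : algebra) :
  (forall e, In e nf3_basis -> satisfies A e) <-> nf3_laws A.
Proof.
  split.
  - intros H.
    assert (H' : Forall (fun e => forall x y z u v w : A,
                   let s := fun n => nth n [x; y; z; u; v; w] x in
                   eval A s (fst e) = eval A s (snd e)) nf3_basis).
    { apply Forall_forall. intros e He x y z u v w s. now apply H. }
    unfold nf3_basis in H'. simpl in H'.
    repeat (apply Forall_cons_iff in H'; destruct H' as [? H']).
    simpl in *.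
    split; intros; auto.
  - intros L e He s. unfold nf3_basis in He. simpl in He.
    repeat (destruct He as [<- | He]; [simpl; destruct L; auto; fail |]).
    destruct He.
Qed.

Lemma nil3_flat_laws (A : algebra) : nil3_flat_semiring A -> nf3_laws A.
Proof.
  intros (o & ((addA & addC & addI & mulA & distl & distr) & zero & flat) & nil).
  assert (top_r : forall a : A, a ⊕ o = o).
  { intros a. destruct (excluded_middle_informative (a = o)) as [-> |]; auto. }
  assert (top_l : forall a : A, o ⊕ a = o) by (intros; rewrite addC; apply top_r).
  assert (left_factor : forall x y : A, x ⊕ x ⊙ y = o).
  { intros x y. destruct (excluded_middle_informative (x = x ⊙ y)) as [E |]; auto.
    transitivity (x ⊙ y ⊙ y); [now rewrite <- !E | apply nil]. }
  assert (right_factor : forall x y : A, x ⊕ y ⊙ x = o).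
  { intros x y. destruct (excluded_middle_informative (x = y ⊙ x)) as [E |]; auto.
    transitivity (y ⊙ y ⊙ x); [now rewrite mulA, <- !E | apply nil]. }
  split; auto; try (intros; rewrite ?nil; auto; fail).
  (* If the two neighbours differ, then already the first two summands of
     either side add up to zero. *)
  all: intros x y z w;
    destruct (excluded_middle_informative (y = z)) as [-> | Hne];
    [ now rewrite addA, (addI (_ ⊙ w)) || now rewrite addA, (addI (w ⊙ _)) |].
  1, 2: now rewrite <- (distr x y z), (flat y z Hne), (proj2 (zero x)), !top_l.
  all: now rewrite <- (distl y z x), (flat y z Hne), (proj1 (zero x)), !top_l.
Qed.

Lemma nf3_laws_of_NF3 (A : algebra) : NF3 A -> nf3_laws A.
Proof.
  intros HA. apply nf3_basis_correct. intros e He.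
  refine (generated_satisfies _ e _ A HA).
  intros B HB.
  now apply (proj2 (nf3_basis_correct B) (nil3_flat_laws B HB)).
Qed.

Lemma gs_add_same (G : graph) (x : gs_elt G) : gs_add x x = x.
Proof. unfold gs_add. now destruct (excluded_middle_informative _). Qed.

Lemma gs_add_diff (G : graph) (x y : gs_elt G) : x <> y -> gs_add x y = gs_zero.
Proof. unfold gs_add. now destruct (excluded_middle_informative _). Qed.

Lemma gs_add_eq (G : graph) (x y v : gs_elt G) :
  v <> gs_zero -> (gs_add x y = v <-> x = v /\ y = v).
Proof.
  intros Hv. unfold gs_add.
  destruct (excluded_middle_informative _); intuition congruence.
Qed.

Lemma gs_mul_omega (G : graph) (x y : gs_elt G) :
  gs_mul x y = gs_omega <->
  exists u v, x = gs_vertex u /\ y = gs_vertex v /\ edge G u v.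
Proof.
  split.
  - destruct x as [u | |], y as [v | |]; simpl; try discriminate.
    destruct (excluded_middle_informative _); try discriminate.
    intros _. now exists u, v.
  - intros (u & v & -> & -> & E). simpl.
    now destruct (excluded_middle_informative _).
Qed.

Lemma gs_mul_cases (G : graph) (x y : gs_elt G) :
  gs_mul x y = gs_zero \/ gs_mul x y = gs_omega.
Proof.
  destruct x, y; simpl; auto. destruct (excluded_middle_informative _); auto.
Qed.

Lemma graph_semiring_nil3_flat (G : graph) : nil3_flat_semiring (graph_semiring G).
Proof.
  assert (H0 : forall x : gs_elt G, gs_add gs_zero x = gs_zero /\ gs_add x gs_zero = gs_zero).
  { intros x. unfold gs_add. split; destruct (excluded_middle_informative _); auto. }
  assert (M0 : forall x : gs_elt G, gs_mul x gs_zero = gs_zero) by now intros [].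
  assert (nil : forall x y z : gs_elt G, gs_mul (gs_mul x y) z = gs_zero).
  { intros x y z. now destruct (gs_mul_cases G x y) as [-> | ->]. }
  assert (nil' : forall x y z : gs_elt G, gs_mul x (gs_mul y z) = gs_zero).
  { intros x y z. destruct (gs_mul_cases G y z) as [-> | ->]; now destruct x. }
  exists gs_zero. split; [split; [| split] |]; simpl.
  - repeat split; simpl.
    + intros x y z.
      destruct (excluded_middle_informative (x = y)) as [-> | Hxy];
        destruct (excluded_middle_informative (y = z)) as [-> | Hyz];
        rewrite ?gs_add_same, ?(gs_add_diff G _ _ Hxy), ?(gs_add_diff G _ _ Hyz);
        rewrite ?gs_add_same, ?(proj1 (H0 _)), ?(proj2 (H0 _));
        rewrite ?(gs_add_diff G _ _ Hxy), ?(gs_add_diff G _ _ Hyz); auto.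
    + intros x y. unfold gs_add.
      destruct (excluded_middle_informative (x = y));
        destruct (excluded_middle_informative (y = x)); congruence.
    + apply gs_add_same.
    + intros x y z. now rewrite nil, nil'.
    + intros x y z.
      destruct (excluded_middle_informative (x = y)) as [-> | Hxy].
      { now rewrite !gs_add_same. }
      rewrite (gs_add_diff G _ _ Hxy). simpl. symmetry.
      destruct (gs_mul_cases G x z) as [-> | E]; [apply H0 |].
      destruct (gs_mul_cases G y z) as [-> | E']; [apply H0 |].
      apply gs_mul_omega in E. destruct E as (u & w & -> & -> & E).
      apply gs_mul_omega in E'. destruct E' as (v & w' & -> & Ew & E').
      injection Ew as <-. now rewrite (in_degree_le1 G _ _ _ E E') in Hxy.
    + intros z x y.
      destruct (excluded_middle_informative (x = y)) as [-> | Hxy].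
      { now rewrite !gs_add_same. }
      rewrite (gs_add_diff G _ _ Hxy), M0. simpl. symmetry.
      destruct (gs_mul_cases G z x) as [-> | E]; [apply H0 |].
      destruct (gs_mul_cases G z y) as [-> | E']; [apply H0 |].
      apply gs_mul_omega in E. destruct E as (w & u & -> & -> & E).
      apply gs_mul_omega in E'. destruct E' as (w' & v & Ew & -> & E').
      injection Ew as <-. now rewrite (out_degree_le1 G _ _ _ E E') in Hxy.
  - auto.
  - intros x y. apply gs_add_diff.
  - apply nil.
Qed.

Lemma graph_semiring_laws (G : graph) : nf3_laws (graph_semiring G).
Proof. apply nil3_flat_laws, graph_semiring_nil3_flat. Qed.

Definition le (A : algebra) (x y : A) : Prop := x ⊕ y = y.

Lemma le_add (A : algebra) (L : nf3_laws A) x y b :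
  le A (x ⊕ y) b <-> le A x b /\ le A y b.
Proof.
  unfold le. split.
  - intros H. split.
    + now rewrite <- H, <- !(add_assoc A L), (add_idem A L).
    + now rewrite <- H, <- !(add_assoc A L), (add_comm A L y x), (add_assoc A L x),
        (add_idem A L).
  - intros [Hx Hy]. now rewrite (add_assoc A L), Hy, Hx.
Qed.

Lemma le_refl (A : algebra) (L : nf3_laws A) x : le A x x.
Proof. apply (add_idem A L). Qed.

Lemma le_antisym (A : algebra) (L : nf3_laws A) x y : le A x y -> le A y x -> x = y.
Proof. unfold le. intros H1 H2. rewrite <- H1, <- H2 at 1. rewrite H1.
  now rewrite (add_comm A L), H1. Qed.

Lemma le_of_add_eq (A : algebra) (L : nf3_laws A) q t b :
  t ⊕ q = t -> le A t b -> le A q b.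
Proof. intros <- H. now apply (le_add A L) in H. Qed.

Lemma le_graph (G : graph) (x v : graph_semiring G) :
  v <> gs_zero -> (le (graph_semiring G) x v <-> x = v).
Proof.
  intros Hv. unfold le. simpl. rewrite (gs_add_eq G x v v Hv). tauto.
Qed.

(** * Separating points by graph semirings *)

(** The two-sided residuals of the ideal below [b]. *)
Definition profile (A : algebra) (b x : A) : (A -> Prop) * (A -> Prop) :=
  ((fun d => le A (x ⊙ d) b), (fun d => le A (d ⊙ x) b)).

Definition active (A : algebra) (b x : A) : Prop :=
  exists d, fst (profile A b x) d \/ snd (profile A b x) d.

(** The cancellation laws make profiles that overlap coincide. *)
Lemma profile_eq (A : algebra) (L : nf3_laws A) b x y d :
  fst (profile A b x) d /\ fst (profile A b y) d \/
  snd (profile A b x) d /\ snd (profile A b y) d ->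
  profile A b x = profile A b y.
Proof.
  assert (H : forall x y,
    (exists d, fst (profile A b x) d /\ fst (profile A b y) d \/
               snd (profile A b x) d /\ snd (profile A b y) d) ->
    forall d, (le A (x ⊙ d) b -> le A (y ⊙ d) b) /\
              (le A (d ⊙ x) b -> le A (d ⊙ y) b)).
  { clear x y d. intros x y [c Hc] d. simpl in Hc.
    destruct Hc as [[Hx Hy] | [Hx Hy]]; split; intros Hd.
    - apply (le_of_add_eq A L _ _ b (cancel_ll A L c x y d)). now rewrite !le_add.
    - apply (le_of_add_eq A L _ _ b (cancel_lr A L c x y d)). now rewrite !le_add.
    - apply (le_of_add_eq A L _ _ b (cancel_rl A L c x y d)). now rewrite !le_add.
    - apply (le_of_add_eq A L _ _ b (cancel_rr A L c x y d)). now rewrite !le_add. }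
  intros Hd. unfold profile.
  f_equal; extensionality c; apply propositional_extensionality; split; intros Hc.
  - apply (H x y); eauto.
  - apply (H y x); [exists d; tauto | trivial].
  - apply (H x y); eauto.
  - apply (H y x); [exists d; tauto | trivial].
Qed.

Lemma profile_mul (A : algebra) (b x y x' y' : A) :
  profile A b x = profile A b x' -> profile A b y = profile A b y' ->
  le A (x ⊙ y) b -> le A (x' ⊙ y') b.
Proof.
  intros Hx Hy H.
  change (fst (profile A b x') y'). rewrite <- Hx.
  change (snd (profile A b y') x). now rewrite <- Hy.
Qed.

(** A class of elements with equal profiles is represented by the profile
    itself. *)
Definition pg_vertex (A : algebra) (b : A) : Type :=
  {p : (A -> Prop) * (A -> Prop) | exists x, active A b x /\ p = profile A b x}.

Definition pg_edge (A : algebra) (b : A) (p q : pg_vertex A b) : Prop :=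
  exists x y, proj1_sig p = profile A b x /\ proj1_sig q = profile A b y /\
              le A (x ⊙ y) b.

Definition pg_class (A : algebra) (b x : A) (H : active A b x) : pg_vertex A b :=
  exist _ (profile A b x) (ex_intro _ x (conj H eq_refl)).

Lemma pg_vertex_eq (A : algebra) (b : A) (p q : pg_vertex A b) :
  proj1_sig p = proj1_sig q -> p = q.
Proof.
  destruct p as [p Hp], q as [q Hq]. simpl. intros ->. f_equal.
  apply Classical_Prop.proof_irrelevance.
Qed.

Lemma pg_no_isolated (A : algebra) (b : A) (p : pg_vertex A b) :
  exists q, pg_edge A b p q \/ pg_edge A b q p.
Proof.
  destruct p as (p & x & Hx & ->). destruct (Hx) as [d [Hd | Hd]].
  - exists (pg_class A b d (ex_intro _ x (or_intror Hd))). left. now exists x, d.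
  - exists (pg_class A b d (ex_intro _ x (or_introl Hd))). right. now exists d, x.
Qed.

Lemma pg_out_degree (A : algebra) (L : nf3_laws A) (b : A) (p q r : pg_vertex A b) :
  pg_edge A b p q -> pg_edge A b p r -> q = r.
Proof.
  intros (x & y & Hx & Hy & H) (x' & z & Hx' & Hz & H').
  apply pg_vertex_eq. rewrite Hy, Hz. apply (profile_eq A L b y z x'). right.
  split; trivial. refine (profile_mul A b x y x' y _ eq_refl H). congruence.
Qed.

Lemma pg_in_degree (A : algebra) (L : nf3_laws A) (b : A) (p q r : pg_vertex A b) :
  pg_edge A b q p -> pg_edge A b r p -> q = r.
Proof.
  intros (y & x & Hy & Hx & H) (z & x' & Hz & Hx' & H').
  apply pg_vertex_eq. rewrite Hy, Hz. apply (profile_eq A L b y z x'). left.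
  split; trivial. refine (profile_mul A b y x y x' eq_refl _ H). congruence.
Qed.

Definition profile_graph (A : algebra) (L : nf3_laws A) (b : A) : graph :=
  @Graph (pg_vertex A b) (pg_edge A b) (pg_no_isolated A b)
    (pg_out_degree A L b) (pg_in_degree A L b).

(** The syntactic quotient of the ideal below [b]: that ideal becomes [omega],
    and elements are otherwise identified by their profiles. *)
Definition to_graph (A : algebra) (L : nf3_laws A) (b x : A) :
  graph_semiring (profile_graph A L b) :=
  if excluded_middle_informative (le A x b) then gs_omega else
  match excluded_middle_informative (active A b x) with
  | left H => @gs_vertex (profile_graph A L b) (pg_class A b x H)
  | right _ => gs_zero
  end.

(** Here and in the next lemmas, the element [a] witnesses that [b] is not the
    top element, so that the ideal below [b] contains no product of three
    factors. *)
Lemma not_active_of_le (A : algebra) (L : nf3_laws A) (a b x : A) :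
  ~ le A a b -> active A b x -> ~ le A x b.
Proof.
  intros Ha [d Hd] Hx. apply Ha.
  assert (H : le A (x ⊙ x ⊙ x) b).
  { destruct Hd as [Hd | Hd]; simpl in Hd.
    - rewrite <- (not_left_factor A L x d). now apply le_add.
    - rewrite <- (not_right_factor A L x d). now apply le_add. }
  apply (le_of_add_eq A L a (x ⊙ x ⊙ x)); trivial.
  rewrite (add_comm A L). apply (cube_top A L).
Qed.

Lemma not_le_product3 (A : algebra) (L : nf3_laws A) (a b x y z : A) :
  ~ le A a b -> ~ le A (x ⊙ y ⊙ z) b.
Proof.
  intros Ha H. apply Ha.
  apply (le_of_add_eq A L a (x ⊙ y ⊙ z)); trivial.
  rewrite (add_comm A L), (nilpotent3 A L x y z x x x). apply (cube_top A L).
Qed.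

Lemma to_graph_omega (A : algebra) (L : nf3_laws A) (b x : A) :
  to_graph A L b x = gs_omega <-> le A x b.
Proof.
  unfold to_graph.
  destruct (excluded_middle_informative (le A x b)); [tauto |].
  destruct (excluded_middle_informative (active A b x)); split;
    (discriminate || tauto).
Qed.

Lemma to_graph_vertex (A : algebra) (L : nf3_laws A) (a b x : A)
    (p : pg_vertex A b) :
  ~ le A a b ->
  (to_graph A L b x = @gs_vertex (profile_graph A L b) p <->
   proj1_sig p = profile A b x).
Proof.
  intros Ha. unfold to_graph.
  assert (Hp : proj1_sig p = profile A b x -> active A b x).
  { destruct p as (p & y & [d Hd] & Hy). simpl. intros E.
    exists d. congruence. }
  destruct (excluded_middle_informative (le A x b)) as [H |].
  { split; [discriminate |]. intros E.
    now destruct (not_active_of_le A L a b x Ha (Hp E)). }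
  destruct (excluded_middle_informative (active A b x)) as [Hx | Hx].
  - split.
    + intros E. injection E as <-. reflexivity.
    + intros E. f_equal. now apply pg_vertex_eq.
  - split; [discriminate | tauto].
Qed.

Lemma to_graph_zero (A : algebra) (L : nf3_laws A) (b x : A) :
  ~ le A x b -> ~ active A b x -> to_graph A L b x = gs_zero.
Proof.
  intros H1 H2. unfold to_graph.
  destruct (excluded_middle_informative (le A x b)); [tauto |].
  now destruct (excluded_middle_informative (active A b x)).
Qed.

Lemma to_graph_hom (A : algebra) (L : nf3_laws A) (a b : A) :
  ~ le A a b ->
  is_hom A (graph_semiring (profile_graph A L b)) (to_graph A L b).
Proof.
  intros Ha. split; intros x y; simpl.
  - assert (Hle := le_add A L x y b).
    assert (Hsum : forall v, v <> gs_zero ->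
      (to_graph A L b (x ⊕ y) = v <-> to_graph A L b x = v /\ to_graph A L b y = v)).
    { intros [p | |] Hv; [| tauto | now rewrite !to_graph_omega].
      rewrite !(to_graph_vertex A L a b _ p Ha).
      clear Hv. destruct p as (p & z & [d Hd] & ->). simpl proj1_sig. split.
      - intros E. rewrite E in Hd. rewrite E.
        destruct Hd as [Hd | Hd]; simpl in Hd.
        + assert (Hd' := Hd). rewrite (mul_add_l A L), (le_add A L) in Hd'.
          split; apply (profile_eq A L b _ _ d); simpl; tauto.
        + assert (Hd' := Hd). rewrite (mul_add_r A L), (le_add A L) in Hd'.
          split; apply (profile_eq A L b _ _ d); simpl; tauto.
      - intros [E1 E2]. rewrite E1 in Hd. rewrite E1.
        assert (Hy : profile A b x = profile A b y) by congruence.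
        apply (profile_eq A L b x (x ⊕ y) d).
        destruct Hd as [Hd | Hd]; [left | right];
          assert (Hd' := Hd); rewrite Hy in Hd'; simpl in *.
        + now rewrite (mul_add_l A L), (le_add A L).
        + now rewrite (mul_add_r A L), (le_add A L). }
    destruct (excluded_middle_informative (to_graph A L b x = to_graph A L b y))
      as [E | E].
    + rewrite <- E, gs_add_same.
      destruct (excluded_middle_informative (to_graph A L b x = gs_zero)) as [E0 | E0].
      * rewrite E0. destruct (excluded_middle_informative
                                (to_graph A L b (x ⊕ y) = gs_zero)) as [| Hne]; trivial.
        exfalso. apply Hne. rewrite <- E0. symmetry. now apply (Hsum _ Hne).
      * now apply Hsum.
    + rewrite (gs_add_diff _ _ _ E).
      destruct (excluded_middle_informative
                  (to_graph A L b (x ⊕ y) = gs_zero)) as [| Hne]; trivial.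
      destruct (proj1 (Hsum _ Hne) eq_refl). congruence.
  - assert (Hactive : ~ active A b (x ⊙ y)).
    { intros [d [Hd | Hd]]; simpl in Hd; revert Hd.
      - now apply (not_le_product3 A L a).
      - rewrite <- (mul_assoc A L). now apply (not_le_product3 A L a). }
    assert (Hiff : gs_mul (to_graph A L b x) (to_graph A L b y) = gs_omega <->
                   le A (x ⊙ y) b).
    { rewrite gs_mul_omega. split.
      - intros (p & q & Hp & Hq & x' & y' & Hx' & Hy' & H).
        apply (to_graph_vertex A L a b _ _ Ha) in Hp, Hq.
        apply (profile_mul A b x' y'); congruence.
      - intros H.
        exists (pg_class A b x (ex_intro _ y (or_introl H))),
          (pg_class A b y (ex_intro _ x (or_intror H))).
        rewrite !(to_graph_vertex A L a b _ _ Ha). repeat split; trivial.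
        now exists x, y. }
    destruct (excluded_middle_informative (le A (x ⊙ y) b)) as [H | H].
    + rewrite (proj2 Hiff H). now apply to_graph_omega.
    + rewrite (to_graph_zero A L b _ H Hactive).
      destruct (gs_mul_cases _ (to_graph A L b x) (to_graph A L b y));
        [congruence | tauto].
Qed.

Lemma to_graph_surj (A : algebra) (L : nf3_laws A) (a b : A) :
  ~ le A a b -> forall v, exists x, to_graph A L b x = v.
Proof.
  intros Ha [p | |].
  - destruct (proj2_sig p) as (x & _ & Hx). exists x.
    now apply (to_graph_vertex A L a b _ _ Ha).
  - exists (a ⊙ a ⊙ a). apply to_graph_zero.
    + now apply (not_le_product3 A L a).
    + intros [d [Hd | Hd]]; simpl in Hd; revert Hd.
      * rewrite (mul_assoc A L a a a). now apply (not_le_product3 A L a).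
      * rewrite <- !(mul_assoc A L), (mul_assoc A L (d ⊙ a)).
        now apply (not_le_product3 A L a).
  - exists b. now apply to_graph_omega, le_refl.
Qed.

Definition graph_quotient (A : algebra) (G : graph) : Prop :=
  exists f : A -> graph_semiring G,
    is_hom A (graph_semiring G) f /\ forall v, exists x, f x = v.

(** If [a] is not below [b], the syntactic quotient at [b] separates them:
    [b] goes to [omega] and [a] does not. *)
Theorem satisfies_of_graph_quotients (A : algebra) e :
  nf3_laws A ->
  (forall G, graph_quotient A G -> satisfies (graph_semiring G) e) ->
  satisfies A e.
Proof.
  intros L HG s.
  assert (Hle : forall x y,
    (x = eval A s (fst e) /\ y = eval A s (snd e)) \/
    (x = eval A s (snd e) /\ y = eval A s (fst e)) -> le A x y).
  { intros x y Hxy. apply Classical_Prop.NNPP. intros H.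
    assert (Hom := to_graph_hom A L x y H).
    assert (HGe := HG (profile_graph A L y)
                     (ex_intro _ _ (conj Hom (to_graph_surj A L x y H)))
                     (fun n => to_graph A L y (s n))).
    rewrite <- !(eval_hom _ _ _ Hom) in HGe.
    assert (E : to_graph A L y x = to_graph A L y y)
      by (destruct Hxy as [[-> ->] | [-> ->]]; congruence).
    apply H. apply (to_graph_omega A L). rewrite E.
    now apply to_graph_omega, le_refl. }
  apply (le_antisym A L); apply Hle; auto.
Qed.

(** * Sums of short words *)

(** All words of length at least three have the same value, that of [W0]. *)
Inductive word : Type :=
| W0 : word
| W1 : nat -> word
| W2 : nat -> nat -> word.

Definition word_term (w : word) : term :=
  match w with
  | W0 => Mul (Mul (Var 0) (Var 0)) (Var 0)
  | W1 i => Var i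
  | W2 i j => Mul (Var i) (Var j)
  end.

Definition word_mul (v w : word) : word :=
  match v, w with
  | W1 i, W1 j => W2 i j
  | _, _ => W0
  end.

Definition word_rename (r : nat -> nat) (w : word) : word :=
  match w with
  | W0 => W0
  | W1 i => W1 (r i)
  | W2 i j => W2 (r i) (r j)
  end.

Definition word_vars (w : word) : list nat :=
  match w with
  | W0 => []
  | W1 i => [i]
  | W2 i j => [i; j]
  end.

Definition weval (A : algebra) (s : nat -> A) (w : word) : A :=
  eval A s (word_term w).

Fixpoint words (t : term) : list word :=
  match t with
  | Var i => [W1 i]
  | Add t u => words t ++ words u
  | Mul t u => flat_map (fun v => map (word_mul v) (words u)) (words t)
  end.

Definition sum_words (w : word) (l : list word) : term :=
  fold_right (fun v t => Add (word_term v) t) (word_term w) l.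

Lemma words_nonempty t : words t <> [].
Proof.
  induction t as [i | t IHt u IHu | t IHt u IHu]; simpl.
  - discriminate.
  - intros E. now apply app_eq_nil in E.
  - destruct (words t), (words u); simpl; congruence.
Qed.

Lemma weval_mul (A : algebra) (L : nf3_laws A) s v w :
  weval A s (word_mul v w) = weval A s v ⊙ weval A s w.
Proof.
  destruct v, w; unfold weval; simpl; trivial;
    rewrite <- ?(mul_assoc A L); apply (nilpotent3 A L).
Qed.

Lemma weval_rename (A : algebra) (L : nf3_laws A) r s w :
  weval A s (word_rename r w) = weval A (fun n => s (r n)) w.
Proof. destruct w; unfold weval; simpl; trivial. apply (nilpotent3 A L). Qed.

(** A term is the sum of its words; this is said through the predicates that
    turn sums into conjunctions, such as being below a given element or taking
    a given nonzero value in a graph semiring. *)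
Lemma eval_words (A : algebra) (L : nf3_laws A) s t :
  forall (P : A -> Prop), (forall x y, P (x ⊕ y) <-> P x /\ P y) ->
  (P (eval A s t) <-> forall w, In w (words t) -> P (weval A s w)).
Proof.
  induction t as [i | t IHt u IHu | t IHt u IHu]; simpl; intros P HP.
  - split; [intros H w [<- | []]; exact H | intros H; exact (H _ (or_introl eq_refl))].
  - rewrite HP, IHt, IHu by trivial. setoid_rewrite in_app_iff. firstorder.
  - rewrite (IHt (fun x => P (x ⊙ eval A s u)))
      by (intros x y; now rewrite (mul_add_l A L)).
    split.
    + intros H w Hw. apply in_flat_map in Hw. destruct Hw as (v1 & Hv1 & Hw).
      apply in_map_iff in Hw. destruct Hw as (v2 & <- & Hv2).
      rewrite (weval_mul A L). specialize (H v1 Hv1).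
      rewrite (IHu (fun x => P (weval A s v1 ⊙ x))) in H; auto.
      intros x y. now rewrite (mul_add_r A L).
    + intros H v1 Hv1. rewrite (IHu (fun x => P (weval A s v1 ⊙ x)))
        by (intros x y; now rewrite (mul_add_r A L)).
      intros v2 Hv2. rewrite <- (weval_mul A L). apply H.
      apply in_flat_map. exists v1. split; trivial. now apply in_map.
Qed.

Lemma eval_sum_words (A : algebra) s w l :
  forall (P : A -> Prop), (forall x y, P (x ⊕ y) <-> P x /\ P y) ->
  (P (eval A s (sum_words w l)) <-> forall v, In v (w :: l) -> P (weval A s v)).
Proof.
  intros P HP. unfold sum_words. induction l as [| v l IH]; simpl.
  - unfold weval. firstorder congruence.
  - rewrite HP, IH. unfold weval. simpl. firstorder congruence.
Qed.

(** The inequality [q <= sum of l], stated without choosing an order for [l]. *)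
Definition entails (A : algebra) (l : list word) (q : word) : Prop :=
  forall s b, (forall w, In w l -> le A (weval A s w) b) -> le A (weval A s q) b.

Lemma entails_incl (A : algebra) l l' q :
  incl l l' -> entails A l q -> entails A l' q.
Proof. intros Hl H s b Hb. apply H. auto. Qed.

Lemma entails_rename (A : algebra) (L : nf3_laws A) r l q :
  entails A l q -> entails A (map (word_rename r) l) (word_rename r q).
Proof.
  intros H s b Hb. rewrite (weval_rename A L). apply H. intros w Hw.
  rewrite <- (weval_rename A L). now apply Hb, in_map.
Qed.

Definition entailment_identity (w : word) (l : list word) (q : word) : identity :=
  (Add (sum_words w l) (word_term q), sum_words w l).

Lemma satisfies_entailment (A : algebra) (L : nf3_laws A) w l q :
  satisfies A (entailment_identity w l q) <-> entails A (w :: l) q.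
Proof.
  split.
  - intros H s b Hb. apply (le_of_add_eq A L _ _ b (H s)).
    apply (eval_sum_words A s w l (fun x => le A x b)); trivial.
    intros x y. apply (le_add A L).
  - intros H s. unfold entailment_identity. simpl. rewrite (add_comm A L).
    apply (H s (eval A s (sum_words w l))).
    apply (eval_sum_words A s w l (fun x => le A x _)).
    + intros x y. apply (le_add A L).
    + apply (le_refl A L).
Qed.

Lemma satisfies_entails (A : algebra) (L : nf3_laws A) t u :
  satisfies A (t, u) <->
  (forall q, In q (words u) -> entails A (words t) q) /\
  (forall q, In q (words t) -> entails A (words u) q).
Proof.
  assert (Hle : forall s b t, le A (eval A s t) b <->
                  forall w, In w (words t) -> le A (weval A s w) b).
  { intros s b t'. apply (eval_words A L s t' (fun x => le A x b)).
    intros x y. apply (le_add A L). }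
  split.
  - intros H. split; intros q Hq s b; rewrite <- Hle; intros Hb;
      assert (E : eval A s t = eval A s u) by exact (H s).
    + apply (Hle s b u); trivial. now rewrite <- E.
    + apply (Hle s b t); trivial. now rewrite E.
  - intros [H1 H2] s. simpl. apply (le_antisym A L); apply Hle; intros q Hq.
    + apply (H2 q Hq). apply Hle, (le_refl A L).
    + apply (H1 q Hq). apply Hle, (le_refl A L).
Qed.

(** A nonempty left side is what makes the entailment an identity: there is no
    empty sum among terms. *)
Lemma entails_of_graph_quotients (A : algebra) l q :
  nf3_laws A -> l <> [] ->
  (forall G, graph_quotient A G -> entails (graph_semiring G) l q) ->
  entails A l q.
Proof.
  intros L Hl HG. destruct l as [| w l]; [easy |].
  apply (satisfies_entailment A L), satisfies_of_graph_quotients; trivial.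
  intros G Hq. apply satisfies_entailment; auto using graph_semiring_laws.
Qed.

Lemma entails_graph (G : graph) l q :
  entails (graph_semiring G) l q <->
  forall s v, v <> gs_zero ->
    (forall w, In w l -> weval (graph_semiring G) s w = v) ->
    weval (graph_semiring G) s q = v.
Proof.
  split.
  - intros H s v Hv Hw. apply le_graph; trivial. apply H.
    intros w Hl. apply le_graph; auto.
  - intros H s v Hw.
    destruct (excluded_middle_informative (v = gs_zero)) as [-> | Hv].
    + unfold le. simpl. unfold gs_add.
      now destruct (excluded_middle_informative _).
    + apply le_graph; trivial. apply H; trivial.
      intros w Hl. apply le_graph; auto.
Qed.

Lemma weval_W2_omega (G : graph) s i j :
  weval (graph_semiring G) s (W2 i j) = gs_omega <->
  exists u v, s i = gs_vertex u /\ s j = gs_vertex v /\ edge G u v.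
Proof. apply gs_mul_omega. Qed.

Lemma weval_W2_nonzero (G : graph) s i j v :
  v <> gs_zero -> weval (graph_semiring G) s (W2 i j) = v -> v = gs_omega.
Proof.
  intros Hv E. unfold weval in E. simpl in E.
  destruct (gs_mul_cases G (s i) (s j)); congruence.
Qed.

(** * Embedding finite pieces of acyclic graphs *)

Definition gs_map {G H : graph} (p : vertex G -> vertex H) (x : gs_elt G) : gs_elt H :=
  match x with
  | gs_vertex u => gs_vertex (p u)
  | gs_zero => gs_zero
  | gs_omega => gs_omega
  end.

Definition gs_vertices {G : graph} (x : gs_elt G) : list (vertex G) :=
  match x with gs_vertex u => [u] | _ => [] end.

Definition used_vertices {G : graph} (s : nat -> gs_elt G) (l : list word) :
  list (vertex G) :=
  flat_map (fun n => gs_vertices (s n)) (flat_map word_vars l).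

Lemma in_used_vertices (G : graph) (s : nat -> gs_elt G) l w i u :
  In w l -> In i (word_vars w) -> s i = gs_vertex u -> In u (used_vertices s l).
Proof.
  intros Hw Hi E. apply in_flat_map. exists i. split.
  - apply in_flat_map. now exists w.
  - rewrite E. now left.
Qed.

Lemma used_vertices_incl (G : graph) (s : nat -> gs_elt G) l l' :
  incl l l' -> incl (used_vertices s l) (used_vertices s l').
Proof.
  intros Hl u Hu. apply in_flat_map in Hu. destruct Hu as (i & Hi & Hu).
  apply in_flat_map in Hi. destruct Hi as (w & Hw & Hi).
  apply in_flat_map. exists i. split; trivial.
  apply in_flat_map. exists w. auto.
Qed.

Lemma length_used_vertices (G : graph) (s : nat -> gs_elt G) l :
  length (used_vertices s l) <= length (flat_map word_vars l).
Proof.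
  unfold used_vertices. induction (flat_map word_vars l) as [| i k IH]; simpl; trivial.
  rewrite length_app. destruct (s i); simpl; lia.
Qed.

Definition induced_embedding {G H : graph} (F : list (vertex G))
    (p : vertex G -> vertex H) : Prop :=
  forall x y, In x F -> In y F ->
    (p x = p y -> x = y) /\ (edge G x y <-> edge H (p x) (p y)).

Lemma weval_induced_embedding (G H : graph) (p : vertex G -> vertex H) s l w :
  induced_embedding (used_vertices s l) p -> In w l ->
  weval (graph_semiring H) (fun n => gs_map p (s n)) w =
  gs_map p (weval (graph_semiring G) s w).
Proof.
  intros Hp Hw. destruct w as [| i | i j]; unfold weval; simpl; trivial.
  - destruct (s 0) as [u | |]; simpl; trivial.
    now repeat destruct (excluded_middle_informative _).
  - destruct (s i) as [u | |] eqn:Ei, (s j) as [v | |] eqn:Ej; simpl; trivial.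
    destruct (Hp u v) as [_ Hiff].
    { apply (in_used_vertices G s l _ i u Hw); simpl; auto. }
    { apply (in_used_vertices G s l _ j v Hw); simpl; auto. }
    destruct (excluded_middle_informative _), (excluded_middle_informative _);
      simpl; tauto.
Qed.

Lemma weval_vertex_used (G : graph) s l w u :
  In w l -> weval (graph_semiring G) s w = gs_vertex u -> In u (used_vertices s l).
Proof.
  intros Hw E. destruct w as [| i | i j]; unfold weval in E; simpl in E.
  - destruct (gs_mul_cases G (s 0) (s 0)) as [E' | E']; rewrite E' in E; discriminate.
  - now apply (in_used_vertices G s l (W1 i) i); simpl; auto.
  - destruct (gs_mul_cases G (s i) (s j)); congruence.
Qed.

(** Isolated vertices of the induced subgraph do no harm here: only products of
    the assigned vertices matter, so entailments pull back along embeddings of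
    finite pieces. *)
Lemma entails_induced_embedding (G H : graph) (p : vertex G -> vertex H) s v l q :
  entails (graph_semiring H) l q -> l <> [] -> v <> gs_zero ->
  (forall w, In w l -> weval (graph_semiring G) s w = v) ->
  induced_embedding (used_vertices s (q :: l)) p ->
  weval (graph_semiring G) s q = v.
Proof.
  intros Hent Hl Hv Hw Hp.
  assert (E : gs_map p (weval (graph_semiring G) s q) = gs_map p v).
  { rewrite <- (weval_induced_embedding G H p s (q :: l)) by (simpl; auto).
    apply (proj1 (entails_graph H l q) Hent).
    - destruct v; simpl; congruence.
    - intros w Hin. rewrite (weval_induced_embedding G H p s (q :: l)) by (simpl; auto).
      now rewrite Hw. }
  destruct l as [| w0 l]; [easy |].
  assert (Hin := Hw w0 (or_introl eq_refl)).
  destruct (weval (graph_semiring G) s q) as [x | |] eqn:Eq, v as [y | |];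
    simpl in E; try congruence.
  f_equal. injection E. apply Hp.
  - apply (weval_vertex_used G s _ q); simpl; auto.
  - apply (weval_vertex_used G s _ w0); simpl; auto.
Qed.

Lemma closed_walk_cycle (G : graph) k : forall c,
  0 < k -> (forall i, i < k -> edge G (c i) (c (S i))) -> c k = c 0 ->
  exists n c', directed_cycle G n c'.
Proof.
  induction k as [k IH] using lt_wf_ind. intros c Hk Hc Hclosed.
  destruct (excluded_middle_informative
              (exists i j, i < j /\ j < k /\ c i = c j)) as [(i & j & Hij & Hj & E) | Hinj].
  - apply (IH (j - i) ltac:(lia) (fun l => c (i + l))); [lia | |].
    + intros l Hl. rewrite Nat.add_succ_r. apply Hc. lia.
    + replace (i + (j - i)) with j by lia. now rewrite Nat.add_0_r.
  - exists k, c. repeat split; trivial.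
    + intros i j Hi Hj E. destruct (lt_eq_lt_dec i j) as [[H | H] | H]; trivial;
        exfalso; apply Hinj; eauto.
    + intros i Hi. apply Hc. lia.
    + rewrite <- Hclosed. replace k with (S (k - 1)) at 2 by lia. apply Hc. lia.
Qed.

Lemma pigeonhole (X : Type) (c : nat -> X) (F : list X) :
  (forall n, In (c n) F) -> exists i j, i < j /\ c i = c j.
Proof.
  intros HF. apply Classical_Prop.NNPP. intros H.
  assert (Hnodup : NoDup (map c (seq 0 (S (length F))))).
  { apply Injective_map_NoDup; [| apply seq_NoDup].
    intros i j E. destruct (lt_eq_lt_dec i j) as [[Hij | Hij] | Hij]; trivial;
      exfalso; apply H; eauto. }
  apply (NoDup_incl_length (l' := F)) in Hnodup.
  - rewrite length_map, length_seq in Hnodup. lia.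
  - intros x Hx. apply in_map_iff in Hx. destruct Hx as (n & <- & _). apply HF.
Qed.

Lemma acyclic_source (G : graph) (F : list (vertex G)) :
  acyclic G -> F <> [] -> exists v, In v F /\ forall u, In u F -> ~ edge G u v.
Proof.
  intros HG HF. apply Classical_Prop.NNPP. intros H.
  destruct F as [| x0 F0]; [easy |]. set (F := x0 :: F0) in *.
  assert (Hpred : forall v, In v F -> exists u, In u F /\ edge G u v).
  { intros v Hv. apply Classical_Prop.NNPP. intros Hu. apply H. exists v.
    split; trivial. intros u Hin Huv. apply Hu. now exists u. }
  set (pred := fun v => epsilon (inhabits x0) (fun u => In u F /\ edge G u v)).
  set (c := fun n => Nat.iter n pred x0).
  assert (Hc : forall n, In (c n) F).
  { induction n as [| n IH]; [now left |].
    exact (proj1 (epsilon_spec (inhabits x0) _ (Hpred _ IH))). }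
  destruct (pigeonhole _ c F Hc) as (i & j & Hij & E).
  destruct (closed_walk_cycle G (j - i) (fun k => c (j - k))) as (n & c' & Hcycle).
  - lia.
  - intros k Hk. replace (j - k) with (S (j - S k)) by lia.
    exact (proj2 (epsilon_spec (inhabits x0) _ (Hpred _ (Hc (j - S k))))).
  - replace (j - (j - i)) with i by lia. now rewrite Nat.sub_0_r.
  - exact (HG n c' Hcycle).
Qed.

Lemma list_bound (X : Type) (f : X -> nat) (l : list X) :
  exists n, forall x, In x l -> f x < n.
Proof.
  induction l as [| y l [n IH]]; [now exists 0 |].
  exists (S (n + f y)). intros x [-> | Hx]; [| apply IH in Hx]; lia.
Qed.

Lemma ray_no_isolated (x : nat) : exists y, y = S x \/ x = S y.
Proof. exists (S x). auto. Qed.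

Lemma ray_out_degree (x y z : nat) : y = S x -> z = S x -> y = z.
Proof. congruence. Qed.

Lemma ray_in_degree (x y z : nat) : x = S y -> x = S z -> y = z.
Proof. congruence. Qed.

Definition ray : graph :=
  @Graph nat (fun x y => y = S x) ray_no_isolated ray_out_degree ray_in_degree.

Lemma ray_acyclic : acyclic ray.
Proof.
  intros n c (Hn & _ & Hc & Hclosed). simpl in *.
  assert (H : forall i, i < n -> c i = c 0 + i).
  { induction i as [| i IH]; intros Hi; [lia |].
    rewrite (Hc i Hi), IH; lia. }
  rewrite (H (n - 1)) in Hclosed; lia.
Qed.

(** A finite piece of an acyclic graph is a union of paths, which fit one after
    the other into a ray, with gaps between them.  Vertices are added back in
    the order opposite to a removal of sources. *)
Lemma acyclic_embeds_ray (G : graph) (F : list (vertex G)) :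
  acyclic G -> exists p : vertex G -> vertex ray, induced_embedding F p.
Proof.
  intros HG.
  set (dec := fun x y : vertex G => excluded_middle_informative (x = y)).
  assert (H : forall n F, length F = n -> NoDup F ->
                exists p : vertex G -> vertex ray, induced_embedding F p).
  { clear F. induction n as [| n IH]; intros F Hlen HF.
    { exists (fun _ => 0). intros x y Hx. destruct F; [destruct Hx | discriminate]. }
    destruct (acyclic_source G F HG) as (v & Hv & Hsource).
    { intros ->. discriminate. }
    destruct (in_split v F Hv) as (l1 & l2 & ->).
    destruct (IH (l1 ++ l2)) as [p Hp].
    { rewrite length_app in *. simpl in *. lia. }
    { now apply NoDup_remove_1 in HF. }
    apply NoDup_remove_2 in HF. set (F := l1 ++ l2) in *.
    assert (HinF : forall x, In x (l1 ++ v :: l2) <-> x = v \/ In x F).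
    { intros x. unfold F. rewrite !in_app_iff. simpl. intuition. }
    setoid_rewrite HinF in Hsource.
    unfold induced_embedding in *. setoid_rewrite HinF. simpl in *.
    destruct (excluded_middle_informative (exists w, In w F /\ edge G v w))
      as [(w & Hw & Hvw) | Hno].
    - (* No vertex sits just before [w], since [v] is its only predecessor;
         so the picture can be opened up there to make room for [v]. *)
      exists (fun x => if dec x v then S (p w)
                       else if p x <? p w then p x else S (S (p x))).
      assert (Hgap : forall x, In x F -> S (p x) <> p w).
      { intros x Hx E. apply HF. rewrite (in_degree_le1 G w v x); trivial.
        now apply Hp. }
      assert (Hout : forall y, In y F -> edge G v y -> y = w).
      { intros y _ Hy. exact (out_degree_le1 G v y w Hy Hvw). }
      intros x y Hx Hy.
      destruct (dec x v) as [-> | Hxv], (dec y v) as [-> | Hyv].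
      + split; [trivial |]. split; [| lia]. intros E. now destruct (Hsource v (or_introl eq_refl)).
      + destruct Hy as [Hy | Hy]; [easy |].
        destruct (Nat.ltb_spec (p y) (p w)); split; try lia.
        * split; [| lia]. intros E. apply Hout in E; trivial. subst. lia.
        * split; [intros E; apply Hout in E; subst; trivial |].
          intros E. replace y with w; trivial. apply (Hp w y); trivial. lia.
      + destruct Hx as [Hx | Hx]; [easy |].
        assert (Hg := Hgap x Hx).
        destruct (Nat.ltb_spec (p x) (p w)); split; try lia;
          (split; [intros E; now destruct (Hsource x (or_intror Hx)) | lia]).
      + destruct Hx as [Hx | Hx], Hy as [Hy | Hy]; try easy.
        assert (Hgx := Hgap x Hx). assert (Hgy := Hgap y Hy).
        destruct (Hp x y Hx Hy) as [Hinj Hedge]. rewrite Hedge.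
        destruct (Nat.ltb_spec (p x) (p w)), (Nat.ltb_spec (p y) (p w));
          split; try lia; intros E; apply Hinj; lia.
    - destruct (list_bound _ p F) as [m Hm].
      exists (fun x => if dec x v then S m else p x).
      intros x y Hx Hy.
      destruct (dec x v) as [-> | Hxv], (dec y v) as [-> | Hyv].
      + split; [trivial |]. split; [| lia]. intros E. now destruct (Hsource v (or_introl eq_refl)).
      + destruct Hy as [Hy | Hy]; [easy |]. apply Hm in Hy as Hlt.
        split; [lia |]. split; [| lia]. intros E. destruct Hno. now exists y.
      + destruct Hx as [Hx | Hx]; [easy |]. apply Hm in Hx as Hlt.
        split; [lia |]. split; [| lia]. intros E. now destruct (Hsource x (or_intror Hx)).
      + destruct Hx as [Hx | Hx], Hy as [Hy | Hy]; try easy. now apply Hp. }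
  destruct (H _ (nodup dec F) eq_refl (NoDup_nodup dec F)) as [p Hp].
  exists p. intros x y Hx Hy. apply Hp; now apply nodup_In.
Qed.

(** * V_ac has no finite basis *)

Lemma V_ac_contains (G : graph) : acyclic G -> V_ac (graph_semiring G).
Proof. intros HG. apply generated_contains. now exists G. Qed.

Lemma V_ac_NF3 : subclass V_ac NF3.
Proof.
  intros A HA. apply HA; [apply is_variety_generated |].
  intros B (G & _ & ->). apply generated_contains, graph_semiring_nil3_flat.
Qed.

Definition next (p i : nat) : nat := if S i =? p then 0 else S i.

Definition cycle_vertex (p : nat) : Type := {i : nat | i < p}.

Definition cycle_edge (p : nat) (x y : cycle_vertex p) : Prop :=
  proj1_sig y = next p (proj1_sig x).

Lemma next_lt p i : i < p -> next p i < p.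
Proof. unfold next. destruct (Nat.eqb_spec (S i) p); lia. Qed.

Lemma cycle_vertex_eq (p : nat) (x y : cycle_vertex p) :
  proj1_sig x = proj1_sig y -> x = y.
Proof.
  destruct x as [i Hi], y as [j Hj]. simpl. intros ->. f_equal. apply le_unique.
Qed.

Lemma cycle_no_isolated (p : nat) (x : cycle_vertex p) :
  exists y, cycle_edge p x y \/ cycle_edge p y x.
Proof.
  destruct x as [i Hi]. exists (exist _ (next p i) (next_lt p i Hi)). now left.
Qed.

Lemma cycle_out_degree (p : nat) (x y z : cycle_vertex p) :
  cycle_edge p x y -> cycle_edge p x z -> y = z.
Proof. unfold cycle_edge. intros H1 H2. apply cycle_vertex_eq. congruence. Qed.

Lemma cycle_in_degree (p : nat) (x y z : cycle_vertex p) :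
  cycle_edge p y x -> cycle_edge p z x -> y = z.
Proof.
  unfold cycle_edge, next. intros H1 H2. apply cycle_vertex_eq.
  rewrite H1 in H2.
  destruct (Nat.eqb_spec (S (proj1_sig y)) p), (Nat.eqb_spec (S (proj1_sig z)) p); lia.
Qed.

Definition cycle_graph (p : nat) : graph :=
  @Graph (cycle_vertex p) (cycle_edge p) (cycle_no_isolated p)
    (cycle_out_degree p) (cycle_in_degree p).

Definition cycle_words (p : nat) : list word :=
  map (fun i => W2 i (next p i)) (seq 0 p).

Lemma acyclic_entails_cycle (G : graph) p :
  acyclic G -> 0 < p -> entails (graph_semiring G) (cycle_words p) W0.
Proof.
  intros HG Hp. apply entails_graph. intros s v Hv Hw. exfalso.
  assert (Hedge : forall i, i < p -> exists x y, s i = gs_vertex x /\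
                    s (next p i) = gs_vertex y /\ edge G x y).
  { intros i Hi. apply weval_W2_omega.
    assert (E : weval (graph_semiring G) s (W2 i (next p i)) = v).
    { apply Hw. apply in_map_iff. exists i. split; trivial. apply in_seq. lia. }
    rewrite E. exact (weval_W2_nonzero G s _ _ v Hv E). }
  destruct (Hedge 0 Hp) as (x0 & _ & _ & _ & _).
  set (c := fun i => match s (if i =? p then 0 else i) with
                     | gs_vertex x => x | _ => x0 end).
  destruct (closed_walk_cycle G p c Hp) as (n & c' & Hcycle).
  - intros i Hi. destruct (Hedge i Hi) as (x & y & Hx & Hy & H). unfold c.
    fold (next p i). destruct (Nat.eqb_spec i p); [lia |].
    now rewrite Hx, Hy.
  - unfold c. rewrite Nat.eqb_refl. now destruct (Nat.eqb_spec 0 p).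
  - exact (HG n c' Hcycle).
Qed.

Lemma cycle_not_entails_cycle p :
  0 < p -> ~ entails (graph_semiring (cycle_graph p)) (cycle_words p) W0.
Proof.
  intros Hp H.
  set (s := fun i => match lt_dec i p with
                     | left Hi => @gs_vertex (cycle_graph p) (exist _ i Hi)
                     | right _ => gs_zero end).
  assert (Hs : forall i (Hi : i < p), exists Hi',
             s i = @gs_vertex (cycle_graph p) (exist _ i Hi')).
  { intros i Hi. unfold s. destruct (lt_dec i p) as [Hi' |]; [now exists Hi' | easy]. }
  assert (E : weval (graph_semiring (cycle_graph p)) s W0 = gs_omega).
  { apply (proj1 (entails_graph _ _ _) H); [discriminate |].
    intros w Hw. apply in_map_iff in Hw. destruct Hw as (i & <- & Hi).
    apply in_seq in Hi. apply weval_W2_omega.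
    destruct (Hs i) as [Hi1 E1]; [lia |].
    destruct (Hs (next p i)) as [Hi2 E2]; [apply next_lt; lia |].
    rewrite E1, E2. now do 2 eexists. }
  unfold weval in E. simpl in E. destruct (gs_mul_cases _ (s 0) (s 0)) as [E' | E'];
    rewrite E' in E; discriminate.
Qed.

(** A cycle with a vertex missing is a path. *)
Lemma cycle_piece_embeds_ray p (F : list (vertex (cycle_graph p))) :
  length F < p -> exists q : vertex (cycle_graph p) -> vertex ray, induced_embedding F q.
Proof.
  intros HF.
  assert (Hm : exists m, m < p /\ ~ In m (map (@proj1_sig _ _) F)).
  { apply Classical_Prop.NNPP. intros H.
    assert (Hincl : incl (seq 0 p) (map (@proj1_sig _ _) F)).
    { intros m Hm. apply in_seq in Hm. apply Classical_Prop.NNPP. intros Hn.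
      apply H. exists m. split; [lia | trivial]. }
    apply NoDup_incl_length in Hincl; [| apply seq_NoDup].
    rewrite length_seq, length_map in Hincl.
    exact (Nat.lt_irrefl _ (Nat.le_lt_trans _ _ _ Hincl HF)). }
  destruct Hm as (m & Hm & Hmissing).
  exists (fun x => if proj1_sig x <=? m then proj1_sig x + p else proj1_sig x).
  intros x y Hx Hy. simpl. unfold cycle_edge, next.
  assert (Hxm : proj1_sig x <> m) by (intros <-; now apply Hmissing, in_map).
  assert (Hym : proj1_sig y <> m) by (intros <-; now apply Hmissing, in_map).
  assert (Hxp := proj2_sig x). assert (Hyp := proj2_sig y). simpl in Hxp, Hyp.
  split.
  - intros E. apply cycle_vertex_eq. revert E.
    destruct (Nat.leb_spec (proj1_sig x) m), (Nat.leb_spec (proj1_sig y) m); lia.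
  - destruct (Nat.leb_spec (proj1_sig x) m), (Nat.leb_spec (proj1_sig y) m),
      (Nat.eqb_spec (S (proj1_sig x)) p); lia.
Qed.

(** An identity of [V_ac] with fewer than [p] occurrences of variables cannot
    see all of a cycle of length [p], hence holds in its graph semiring; but
    that semiring is not in [V_ac]. *)
Theorem V_ac_not_finitely_based : ~ finitely_based V_ac.
Proof.
  intros [E HE].
  destruct (list_bound _ (fun e => length (flat_map word_vars
              (words (fst e) ++ words (snd e)))) E) as [n Hn].
  set (p := S n).
  apply (cycle_not_entails_cycle p); [lia |].
  assert (Hcycle : V_ac (graph_semiring (cycle_graph p))).
  { apply HE. intros [t u] He.
    assert (Hray : satisfies (graph_semiring ray) (t, u)).
    { apply HE; trivial. apply V_ac_contains, ray_acyclic. }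
    apply (satisfies_entails _ (graph_semiring_laws _)) in Hray.
    destruct Hray as [H1 H2]. apply Hn in He. simpl in He.
    assert (Hlift : forall l q, incl (q :: l) (words t ++ words u) -> l <> [] ->
              entails (graph_semiring ray) l q ->
              entails (graph_semiring (cycle_graph p)) l q).
    { intros l q Hincl Hl H. apply entails_graph. intros s v Hv Hw.
      destruct (cycle_piece_embeds_ray p (used_vertices s (words t ++ words u)))
        as [f Hf].
      { eapply Nat.le_lt_trans; [apply length_used_vertices | lia]. }
      apply (entails_induced_embedding _ ray f s v l q); trivial.
      intros x y Hx Hy. apply Hf; eapply used_vertices_incl; eauto. }
    apply (satisfies_entails _ (graph_semiring_laws _)).
    split; intros q Hq; apply Hlift; auto using words_nonempty.
    - intros w [<- | Hw]; apply in_or_app; auto.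
    - intros w [<- | Hw]; apply in_or_app; auto. }
  assert (Hne : cycle_words p <> []) by discriminate.
  destruct (cycle_words p) as [| w l] eqn:El; [easy |].
  apply satisfies_entailment; [apply graph_semiring_laws |].
  refine (generated_satisfies _ _ _ _ Hcycle).
  intros A (G & HG & ->). apply satisfies_entailment; [apply graph_semiring_laws |].
  rewrite <- El. apply acyclic_entails_cycle; [trivial | lia].
Qed.

(** * Varieties with bounded paths *)

Definition has_path (G : graph) (n : nat) : Prop :=
  exists c : nat -> vertex G,
    (forall i, S i < n -> edge G (c i) (c (S i))) /\
    (forall i j, i < n -> j < n -> c i = c j -> i = j).

(** Long paths contain all finite pieces of acyclic graphs as induced subgraphs,
    so graphs with ever longer paths generate [V_ac]. *)
Lemma bounded_paths (W : algebra -> Prop) :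
  is_variety W -> ~ subclass V_ac W ->
  exists n, forall G, W (graph_semiring G) -> ~ has_path G n.
Proof.
  intros HW Hnot. apply Classical_Prop.NNPP. intros Hlong. apply Hnot.
  intros B HB. apply HB; trivial. intros A (G & HG & ->).
  apply birkhoff; trivial. intros [t u] He.
  assert (Hlift : forall l q, l <> [] ->
            (forall H, W (graph_semiring H) -> entails (graph_semiring H) l q) ->
            entails (graph_semiring G) l q).
  { intros l q Hl Hent. apply entails_graph. intros s v Hv Hw.
    destruct (acyclic_embeds_ray G (used_vertices s (q :: l)) HG) as [f Hf].
    destruct (list_bound _ f (used_vertices s (q :: l))) as [n Hn].
    (* One more vertex than needed, as the two ends of the path may be joined
       by an edge. *)
    assert (Hpath : exists H, W (graph_semiring H) /\ has_path H (S n)).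
    { apply Classical_Prop.NNPP. intros Hno. apply Hlong. exists (S n).
      intros H HH Hp. apply Hno. now exists H. }
    destruct Hpath as (H & HH & c & Hc & Hinj).
    apply (entails_induced_embedding G H (fun x => c (f x)) s v l q); auto.
    intros x y Hx Hy. destruct (Hf x y Hx Hy) as [Hfinj Hfedge].
    apply Hn in Hx, Hy. split.
    - intros E. apply Hfinj, Hinj; trivial; lia.
    - rewrite Hfedge. simpl. split.
      + intros ->. apply Hc. lia.
      + intros E. apply Hinj; try lia.
        apply (out_degree_le1 H (c (f x))); trivial. apply Hc. lia. }
  assert (Hent : forall H, W (graph_semiring H) ->
      (forall q, In q (words u) -> entails (graph_semiring H) (words t) q) /\
      (forall q, In q (words t) -> entails (graph_semiring H) (words u) q)).
  { intros H HH. apply satisfies_entails; [apply graph_semiring_laws | now apply He]. }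
  apply (satisfies_entails _ (graph_semiring_laws G)).
  split; intros q Hq; apply Hlift; auto using words_nonempty;
    intros H HH; now apply (Hent H HH).
Qed.

Fixpoint steps (G : graph) (k : nat) (x y : vertex G) : Prop :=
  match k with
  | 0 => x = y
  | S k => exists z, edge G x z /\ steps G k z y
  end.

Lemma steps_add (G : graph) j k : forall x y z,
  steps G j x y -> steps G k y z -> steps G (j + k) x z.
Proof.
  induction j as [| j IH]; simpl; intros x y z.
  - now intros ->.
  - intros (x' & Hx & H) Hk. exists x'. split; trivial. now apply (IH x' y).
Qed.

Lemma steps_split (G : graph) j k : forall x z,
  steps G (j + k) x z -> exists y, steps G j x y /\ steps G k y z.
Proof.
  induction j as [| j IH]; simpl; intros x z H.
  - now exists x.
  - destruct H as (x' & Hx & H). destruct (IH x' z H) as (y & H1 & H2).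
    exists y. eauto.
Qed.

Lemma steps_fun (G : graph) k : forall x y z,
  steps G k x y -> steps G k x z -> y = z.
Proof.
  induction k as [| k IH]; simpl; intros x y z.
  - congruence.
  - intros (x1 & Hx1 & H1) (x2 & Hx2 & H2).
    rewrite (out_degree_le1 G x x1 x2 Hx1 Hx2) in H1. eauto.
Qed.

Lemma steps_inj (G : graph) k : forall x y z,
  steps G k y x -> steps G k z x -> y = z.
Proof.
  induction k as [| k IH]; simpl; intros x y z.
  - congruence.
  - intros (y1 & Hy1 & H1) (z1 & Hz1 & H2).
    rewrite (IH x y1 z1 H1 H2) in Hy1. exact (in_degree_le1 G z1 y z Hy1 Hz1).
Qed.

Lemma steps_1 (G : graph) x y : edge G x y <-> steps G 1 x y.
Proof. simpl. split; [eauto |]. now intros (z & H & <-). Qed.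

Lemma steps_mul (G : graph) m x : steps G m x x -> forall k, steps G (k * m) x x.
Proof.
  intros H. induction k as [| k IH]; simpl; trivial. now apply (steps_add G _ _ x x x).
Qed.

Lemma steps_walk (G : graph) k : forall x y, steps G k x y ->
  exists c, c 0 = x /\ c k = y /\ forall i, i < k -> edge G (c i) (c (S i)).
Proof.
  induction k as [| k IH]; simpl; intros x y H.
  - exists (fun _ => x). repeat split; trivial. lia.
  - destruct H as (z & Hz & H). destruct (IH z y H) as (c & <- & <- & Hc).
    exists (fun i => match i with 0 => x | S i => c i end).
    repeat split; trivial. intros [| i] Hi; trivial. apply Hc. lia.
Qed.

(** ** Graphs in which all walks of a given length are closed *)

Definition closing (G : graph) (m : nat) : Prop :=
  forall x y, steps G m x y -> x = y.

Definition walk_words (m : nat) : list word := map (fun i => W2 i (S i)) (seq 0 m).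

(** The forced edge makes the second vertex of the walk a successor of both of
    its ends. *)
Lemma closing_of_entails (G : graph) m :
  0 < m -> entails (graph_semiring G) (walk_words m) (W2 m 1) -> closing G m.
Proof.
  intros Hm H x y Hxy. destruct (steps_walk G m x y Hxy) as (c & <- & <- & Hc).
  apply (in_degree_le1 G (c 1)); [now apply Hc |].
  assert (E : weval (graph_semiring G) (fun i => gs_vertex (c i)) (W2 m 1) = gs_omega).
  { apply (proj1 (entails_graph _ _ _) H); [discriminate |].
    intros w Hw. apply in_map_iff in Hw. destruct Hw as (i & <- & Hi).
    apply in_seq in Hi. apply weval_W2_omega. do 2 eexists. repeat split.
    apply Hc. lia. }
  apply weval_W2_omega in E. destruct E as (u & v & Eu & Ev & E). congruence.
Qed.

Lemma divide_fact d n : 0 < d <= n -> Nat.divide d (fact n).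
Proof.
  induction n as [| n IH]; intros Hd; [lia |].
  destruct (Nat.eq_dec d (S n)) as [-> | Hne].
  - simpl. exists (fact n). lia.
  - change (fact (S n)) with (S n * fact n).
    apply Nat.divide_mul_r, IH. lia.
Qed.

(** A walk with more than [n] vertices repeats a vertex, so it runs around a
    cycle of length at most [n].  The factorial is a multiple of that length, and
    it is large enough for such a walk to exist. *)
Lemma entails_of_bounded_paths (G : graph) n :
  ~ has_path G (S n) ->
  entails (graph_semiring G) (walk_words (fact (S n))) (W2 (fact (S n)) 1).
Proof.
  intros Hno. apply entails_graph. intros s v Hv Hw. set (m := fact (S n)) in *.
  assert (Hnm : S n <= m).
  { unfold m. apply Nat.divide_pos_le; [apply lt_O_fact |]. apply divide_fact. lia. }
  assert (Hedge : forall i, i < m -> v = gs_omega /\ exists x y,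
            s i = gs_vertex x /\ s (S i) = gs_vertex y /\ edge G x y).
  { intros i Hi.
    assert (E : weval (graph_semiring G) s (W2 i (S i)) = v).
    { apply Hw. apply in_map_iff. exists i. split; trivial. apply in_seq. lia. }
    assert (Ev := weval_W2_nonzero G s _ _ v Hv E). split; trivial.
    apply weval_W2_omega. congruence. }
  destruct (Hedge 0) as (-> & x0 & _ & E0 & _); [lia |].
  set (c := fun i => match s i with gs_vertex x => x | _ => x0 end).
  assert (Hc : forall i, i < m -> edge G (c i) (c (S i))).
  { intros i Hi. destruct (Hedge i Hi) as (_ & x & y & Hx & Hy & H). unfold c.
    now rewrite Hx, Hy. }
  assert (Hs : forall i, i <= m -> s i = gs_vertex (c i)).
  { intros [| i] Hi.
    - unfold c. now rewrite E0.
    - destruct (Hedge i Hi) as (_ & x & y & _ & Hy & _). unfold c. now rewrite Hy. }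
  assert (Hrep : exists i d, 0 < d /\ i + d < S n /\ c i = c (i + d)).
  { apply Classical_Prop.NNPP. intros H. apply Hno. exists c. split.
    - intros i Hi. apply Hc. lia.
    - intros i j Hi Hj E. destruct (lt_eq_lt_dec i j) as [[Hij | Hij] | Hij]; trivial;
        destruct H.
      + exists i, (j - i). replace (i + (j - i)) with j by lia. split; [lia |].
        split; [lia | trivial].
      + exists j, (i - j). replace (j + (i - j)) with i by lia. split; [lia |].
        split; [lia | congruence]. }
  destruct Hrep as (i & d & Hd & Hid & E).
  assert (Eback : c 0 = c d).
  { revert Hid E. induction i as [| i IH]; intros Hid E; trivial.
    apply IH; [lia |]. apply (in_degree_le1 G (c (S i))); [apply Hc; lia |].
    rewrite E. apply Hc. lia. }
  assert (Eforth : forall k, k + d <= m -> c k = c (k + d)).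
  { induction k as [| k IH]; intros Hk; trivial.
    apply (out_degree_le1 G (c k)); [apply Hc; lia |].
    rewrite IH by lia. apply Hc. lia. }
  assert (Emul : forall k, k * d <= m -> c (k * d) = c 0).
  { induction k as [| k IH]; simpl; intros Hk; trivial.
    rewrite Nat.add_comm, <- Eforth, IH; trivial; lia. }
  destruct (divide_fact d (S n)) as [k Hk]; [lia |].
  apply weval_W2_omega. exists (c m), (c 1). rewrite !Hs by lia. repeat split.
  unfold m at 1. rewrite Hk, Emul by (fold m in Hk; lia). apply Hc. lia.
Qed.

(** ** Folding a graph onto boundedly many vertices *)

Definition connected (G : graph) (x y : vertex G) : Prop :=
  exists k, steps G k x y \/ steps G k y x.

Lemma connected_sym (G : graph) x y : connected G x y -> connected G y x.
Proof. intros [k H]. exists k. tauto. Qed.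

Lemma connected_trans (G : graph) x y z :
  connected G x y -> connected G y z -> connected G x z.
Proof.
  intros [j Hj] [k Hk]. destruct Hj as [Hj | Hj], Hk as [Hk | Hk].
  - exists (j + k). left. now apply (steps_add G j k x y z).
  - destruct (le_lt_dec k j) as [H | H].
    + exists (j - k). left. replace j with (j - k + k) in Hj by lia.
      apply steps_split in Hj. destruct Hj as (w & H1 & H2).
      now rewrite (steps_inj G k y z w Hk H2).
    + exists (k - j). right. replace k with (k - j + j) in Hk by lia.
      apply steps_split in Hk. destruct Hk as (w & H1 & H2).
      now rewrite (steps_inj G j y x w Hj H2).
  - destruct (le_lt_dec k j) as [H | H].
    + exists (j - k). right. replace j with (k + (j - k)) in Hj by lia.
      apply steps_split in Hj. destruct Hj as (w & H1 & H2).
      now rewrite (steps_fun G k y z w Hk H1).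
    + exists (k - j). left. replace k with (j + (k - j)) in Hk by lia.
      apply steps_split in Hk. destruct Hk as (w & H1 & H2).
      now rewrite (steps_fun G j y x w Hj H1).
  - exists (k + j). right. now apply (steps_add G k j z y x).
Qed.

Definition is_root (G : graph) (m : nat) (x r : vertex G) : Prop :=
  connected G x r /\ forall y, connected G x y -> exists k, k < m /\ steps G k r y.

(** Walk back from [x] at most [m] steps.  Either this gets stuck at a source,
    from which no walk has length [m], or the component is a cycle. *)
Lemma root_exists (G : graph) m x :
  0 < m -> closing G m -> exists r, is_root G m x r.
Proof.
  intros Hm Hclose.
  destruct (excluded_middle_informative (exists y, steps G m y x)) as [[y Hy] | Hno].
  - assert (Hx : steps G m x x).
    { now rewrite (Hclose y x Hy) in Hy. }
    exists x. split; [now exists 0; left |].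
    intros z [k Hk].
    assert (Hz : exists j, steps G j x z).
    { destruct Hk as [Hk | Hk]; [now exists k |].
      exists (k * m - k).
      assert (H := steps_mul G m x Hx k).
      replace (k * m) with (k * m - k + k) in H by nia.
      apply steps_split in H. destruct H as (w & H1 & H2).
      now rewrite (steps_inj G k x z w Hk H2). }
    destruct Hz as [j Hj]. exists (j mod m).
    split; [apply Nat.mod_upper_bound; lia |].
    rewrite (Nat.div_mod_eq j m) in Hj. apply steps_split in Hj.
    destruct Hj as (w & H1 & H2).
    rewrite Nat.mul_comm in H1.
    now rewrite (steps_fun G _ _ _ _ (steps_mul G m x Hx (j / m)) H1).
  - assert (Hsource : forall n, ~ (exists y, steps G n y x) ->
              exists r k, steps G k r x /\ forall z, ~ edge G z r).
    { induction n as [| n IH]; intros Hn.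
      - destruct Hn. now exists x.
      - destruct (excluded_middle_informative (exists y, steps G n y x))
          as [[y Hy] | Hn']; [| now apply IH].
        exists y, n. split; trivial. intros z Hz. apply Hn.
        exists z, y. now split. }
    destruct (Hsource m Hno) as (r & k & Hk & Hr).
    exists r. split; [exists k; now right |].
    intros y Hy.
    assert (Hry : connected G r y)
      by (apply (connected_trans G r x y); trivial; exists k; now left).
    assert (Hpred : forall j z, steps G j z r -> j = 0).
    { intros [| j] z Hj; trivial. replace (S j) with (j + 1) in Hj by lia.
      apply steps_split in Hj. destruct Hj as (w & _ & Hw).
      apply steps_1 in Hw. now destruct (Hr w). }
    destruct Hry as [j [Hj | Hj]].
    + exists j. split; trivial. destruct (le_lt_dec m j) as [Hle |]; trivial.
      exfalso. replace j with (m + (j - m)) in Hj by lia.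
      apply steps_split in Hj. destruct Hj as (w & Hw & _).
      assert (E := Hclose r w Hw). subst w. apply Hpred in Hw. lia.
    + assert (E := Hpred j y Hj). subst j. exists 0. now split.
Qed.

Definition root (G : graph) (m : nat) (x : vertex G) : vertex G :=
  epsilon (inhabits x) (is_root G m x).

Lemma root_spec (G : graph) m x :
  0 < m -> closing G m -> is_root G m x (root G m x).
Proof. intros Hm Hc. unfold root. apply epsilon_spec. now apply root_exists. Qed.

Lemma root_connected (G : graph) m x y :
  connected G x y -> root G m x = root G m y.
Proof.
  intros H. unfold root.
  assert (E : is_root G m x = is_root G m y).
  { extensionality r. apply propositional_extensionality. unfold is_root.
    split; intros [H1 H2]; split.
    - apply (connected_trans G y x r); trivial. now apply connected_sym.
    - intros z Hz. apply H2. now apply (connected_trans G x y z).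
    - now apply (connected_trans G x y r).
    - intros z Hz. apply H2. apply (connected_trans G y x z); trivial.
      now apply connected_sym. }
  rewrite E. f_equal. apply Classical_Prop.proof_irrelevance.
Qed.

Definition truth (P : Prop) : bool :=
  if excluded_middle_informative P then true else false.

Lemma truth_eq (P Q : Prop) : truth P = truth Q -> P -> Q.
Proof.
  unfold truth.
  now destruct (excluded_middle_informative P), (excluded_middle_informative Q).
Qed.

(** All that has to be known of [r] and [r'] in order to send the vertex [k]
    steps after [r] to the vertex [k] steps after [r']; being a bit list of fixed
    length, it takes boundedly many values. *)
Definition shape (G : graph) (m : nat) (r : vertex G) : list bool * list bool :=
  (map (fun k => truth (exists y, steps G k r y)) (seq 0 (S m)),
   map (fun k => truth (steps G k r r)) (seq 0 (S m))).

Lemma shape_eq (G : graph) m r r' k :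
  shape G m r = shape G m r' -> k <= m ->
  ((exists y, steps G k r y) -> exists y, steps G k r' y) /\
  (steps G k r r -> steps G k r' r').
Proof.
  intros E Hk. unfold shape in E. apply pair_equal_spec in E. destruct E as [E1 E2].
  assert (Hin : In k (seq 0 (S m))) by (apply in_seq; lia).
  split; apply truth_eq.
  - exact (ext_in_map E1 k Hin).
  - exact (ext_in_map E2 k Hin).
Qed.

Fixpoint bit_lists (n : nat) : list (list bool) :=
  match n with
  | 0 => [[]]
  | S n => map (cons true) (bit_lists n) ++ map (cons false) (bit_lists n)
  end.

Lemma in_bit_lists l : In l (bit_lists (length l)).
Proof.
  induction l as [| b l IH]; simpl; [now left |].
  apply in_or_app. destruct b; [left | right]; now apply in_map.
Qed.

Definition shapes (m : nat) : list (list bool * list bool) :=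
  list_prod (bit_lists (S m)) (bit_lists (S m)).

Lemma in_shapes (G : graph) m r : In (shape G m r) (shapes m).
Proof.
  apply in_prod.
  - rewrite <- (length_seq (S m) 0) at 2.
    rewrite <- (length_map (fun k => truth (exists y, steps G k r y))). apply in_bit_lists.
  - rewrite <- (length_seq (S m) 0) at 2.
    rewrite <- (length_map (fun k => truth (steps G k r r))). apply in_bit_lists.
Qed.

Lemma least_nat (P : nat -> Prop) :
  (exists k, P k) -> exists k, P k /\ forall j, j < k -> ~ P j.
Proof.
  intros [k Hk]. revert Hk. induction k as [k IH] using lt_wf_ind. intros Hk.
  destruct (excluded_middle_informative (exists j, j < k /\ P j)) as [(j & Hj & HP) | H].
  - exact (IH j Hj HP).
  - exists k. split; trivial. intros j Hj HP. apply H. now exists j.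
Qed.

Definition folding_bound (m : nat) : nat := (3 + length (shapes m)) * m.

(** Components with roots of equal shape are alike, so one of each shape is
    enough, besides those that meet [L].  A vertex at distance [k] from its
    root goes to the vertex at distance [k] from the chosen root. *)
Lemma folding (G : graph) m (L : list (vertex G)) :
  0 < m -> closing G m -> length L <= 3 ->
  exists (h : vertex G -> vertex G) (F : list (vertex G)),
    (forall x y, edge G x y -> edge G (h x) (h y)) /\
    (forall x, In x L -> h x = x) /\
    (forall x, In (h x) F) /\
    length F <= folding_bound m.
Proof.
  intros Hm Hclose HL.
  destruct (excluded_middle_informative (exists x : vertex G, True)) as [[x0 _] | Hempty].
  2: { exists (fun x => x), []. repeat split; trivial; [| simpl; lia].
       intros x. destruct Hempty. now exists x. }
  set (rep := fun t => epsilon (inhabits x0) (fun r => shape G m r = t)).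
  set (target := fun r => if excluded_middle_informative (In r (map (root G m) L))
                          then r else rep (shape G m r)).
  set (dist := fun x => epsilon (inhabits 0) (fun k => steps G k (root G m x) x /\
                          forall j, j < k -> ~ steps G j (root G m x) x)).
  set (advance := fun k r => epsilon (inhabits x0) (fun y => steps G k r y)).
  assert (Htarget : forall r, shape G m r = shape G m (target r)).
  { intros r. unfold target. destruct (excluded_middle_informative _); trivial.
    symmetry. apply (epsilon_spec (inhabits x0) (fun r' => shape G m r' = shape G m r)).
    now exists r. }
  assert (Hdist : forall x, steps G (dist x) (root G m x) x /\
                    forall j, j < dist x -> ~ steps G j (root G m x) x).
  { intros x. unfold dist. apply epsilon_spec, least_nat.
    destruct (root_spec G m x Hm Hclose) as [_ Hr].
    destruct (Hr x) as (k & _ & Hk); [now exists 0; left | now exists k]. }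
  assert (Hlt : forall x, dist x < m).
  { intros x. destruct (root_spec G m x Hm Hclose) as [_ Hr].
    destruct (Hr x) as (k & Hk & Hkx); [now exists 0; left |].
    destruct (le_lt_dec (dist x) k) as [H | H]; [lia |].
    now destruct (proj2 (Hdist x) k H). }
  assert (Hadvance : forall k r, k <= m -> (exists y, steps G k r y) ->
            steps G k (target r) (advance k (target r))).
  { intros k r Hk Hy. unfold advance. apply epsilon_spec.
    now apply (shape_eq G m r). }
  set (h := fun x => advance (dist x) (target (root G m x))).
  assert (Hh : forall x, steps G (dist x) (target (root G m x)) (h x)).
  { intros x. apply Hadvance; [specialize (Hlt x); lia |]. exists x. apply Hdist. }
  exists h, (flat_map (fun r => map (fun k => advance k r) (seq 0 m))
               (map (root G m) L ++ map rep (shapes m))).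
  split; [| split; [| split]].
  - intros x y Hxy.
    assert (Er : root G m x = root G m y)
      by (apply root_connected; exists 1; left; now apply steps_1).
    assert (Hx := Hh x). assert (Hy := Hh y). rewrite <- Er in Hy.
    destruct (Hdist x) as [Hdx Hminx]. destruct (Hdist y) as [Hdy Hminy].
    rewrite <- Er in Hdy, Hminy. set (r := root G m x) in *.
    assert (Hstep : steps G (dist x + 1) r y)
      by (apply (steps_add G _ _ r x y); trivial; now apply steps_1).
    destruct (Nat.eq_dec (dist y) (dist x + 1)) as [E | Hne].
    + rewrite E in Hy. apply steps_split in Hy. destruct Hy as (w & H1 & H2).
      rewrite (steps_fun G _ _ _ _ Hx H1). now apply steps_1.
    + (* The walk through [x] reaches [y] late: [y] is the root, on a cycle. *)
      assert (Hle : dist y < dist x + 1).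
      { destruct (le_lt_dec (dist y) (dist x + 1)) as [H | H]; [lia |].
        now destruct (Hminy _ H). }
      destruct (dist y) as [| j] eqn:Ey.
      * simpl in Hdy, Hy. subst y. rewrite <- Hy.
        assert (Hloop : steps G (dist x + 1) (target r) (target r)).
        { apply (shape_eq G m r); trivial. specialize (Hlt x). lia. }
        apply steps_split in Hloop. destruct Hloop as (w & H1 & H2).
        rewrite (steps_fun G _ _ _ _ Hx H1). now apply steps_1.
      * exfalso. apply (Hminx j); [lia |].
        replace (S j) with (j + 1) in Hdy by lia.
        apply steps_split in Hdy. destruct Hdy as (w & H1 & H2).
        apply steps_1 in H2. now rewrite (in_degree_le1 G y x w Hxy H2).
  - intros x Hx.
    assert (E : target (root G m x) = root G m x).
    { unfold target. destruct (excluded_middle_informative _) as [| Hn]; trivial.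
      destruct Hn. now apply in_map. }
    assert (H := Hh x). rewrite E in H.
    exact (steps_fun G _ _ _ _ H (proj1 (Hdist x))).
  - intros x. apply in_flat_map. exists (target (root G m x)). split.
    + apply in_or_app. unfold target.
      destruct (excluded_middle_informative _) as [Hin |]; [now left | right].
      apply in_map, in_shapes.
    + unfold h. apply (in_map (fun k => advance k (target (root G m x)))).
      apply in_seq. specialize (Hlt x). lia.
  - rewrite (flat_map_constant_length (c := m)).
    + rewrite length_app, !length_map. unfold folding_bound.
      apply Nat.mul_le_mono_r. lia.
    + intros r _. now rewrite length_map, length_seq.
Qed.

(** * Finite bases *)

Fixpoint sublists {X : Type} (l : list X) : list (list X) :=
  match l with
  | [] => [[]]
  | x :: l => map (cons x) (sublists l) ++ sublists l
  end.

Lemma filter_in_sublists (X : Type) (f : X -> bool) l : In (filter f l) (sublists l).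
Proof.
  induction l as [| x l IH]; simpl; [now left |].
  apply in_or_app. destruct (f x); [left; now apply in_map | now right].
Qed.

Definition short_words (n : nat) : list word :=
  W0 :: map W1 (seq 0 n) ++ flat_map (fun i => map (W2 i) (seq 0 n)) (seq 0 n).

Lemma in_short_words n w :
  (forall i, In i (word_vars w) -> i < n) -> In w (short_words n).
Proof.
  destruct w as [| i | i j]; simpl; intros H; [now left | |]; right; apply in_or_app.
  - left. apply in_map, in_seq. specialize (H i). intuition lia.
  - right. apply in_flat_map. exists i.
    split; [| apply in_map]; apply in_seq; [specialize (H i) | specialize (H j)];
      intuition lia.
Qed.

Definition small_identities (n : nat) : list identity :=
  flat_map (fun w => flat_map (fun l => map (entailment_identity w l) (short_words n))
                       (sublists (short_words n)))
    (short_words n).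

Definition small_basis (W : algebra -> Prop) (n : nat) : list identity :=
  nf3_basis ++ filter (fun e => truth (valid W e)) (small_identities n).

Lemma truth_true (P : Prop) : truth P = true <-> P.
Proof. unfold truth. now destruct (excluded_middle_informative P). Qed.

(** Only the set of words of [l] matters, and this set is also listed by one of
    the sublists of [short_words n]. *)
Lemma small_basis_entails (W : algebra -> Prop) n (B : algebra) l q :
  subclass W NF3 -> nf3_laws B ->
  (forall e, In e (small_basis W n) -> satisfies B e) ->
  l <> [] -> incl (q :: l) (short_words n) ->
  (forall A, W A -> entails A l q) -> entails B l q.
Proof.
  intros HW LB HB Hl Hincl Hent. destruct l as [| w l]; [easy |].
  set (l' := filter (fun v => truth (In v (w :: l))) (short_words n)).
  assert (Hl' : forall v, In v l' <-> In v (w :: l)).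
  { intros v. unfold l'. rewrite filter_In, truth_true. split; [tauto |].
    intros Hv. split; trivial. apply Hincl. now right. }
  apply (entails_incl B (w :: l')).
  { intros v [-> | Hv]; [now left | now apply Hl']. }
  apply (satisfies_entailment B LB), HB, in_or_app. right.
  apply filter_In. split.
  - apply in_flat_map. exists w. split; [apply Hincl; simpl; auto |].
    apply in_flat_map. exists l'. split; [apply filter_in_sublists |].
    apply in_map, Hincl. now left.
  - apply truth_true. intros A HA.
    apply (satisfies_entailment A (nf3_laws_of_NF3 A (HW A HA))).
    apply (entails_incl A (w :: l)); auto.
    intros v Hv. right. now apply Hl'.
Qed.

Lemma weval_gs_map (G : graph) (h : vertex G -> vertex G) s w v :
  (forall x y, edge G x y -> edge G (h x) (h y)) -> v <> gs_zero ->
  weval (graph_semiring G) s w = v ->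
  weval (graph_semiring G) (fun n => gs_map h (s n)) w = gs_map h v.
Proof.
  intros Hh Hv E. destruct w as [| i | i j].
  - unfold weval in E. simpl in E.
    destruct (gs_mul_cases G (s 0) (s 0)) as [E' | E']; rewrite E' in E;
      simpl in E; congruence.
  - unfold weval in *. simpl in *. now rewrite E.
  - assert (Ev := weval_W2_nonzero G s i j v Hv E). rewrite Ev in E |- *.
    simpl. apply weval_W2_omega in E.
    destruct E as (x & y & Hx & Hy & E). apply weval_W2_omega.
    exists (h x), (h y). rewrite Hx, Hy. auto.
Qed.

Lemma weval_ext (A : algebra) (L : nf3_laws A) s s' w :
  (forall i, In i (word_vars w) -> s i = s' i) -> weval A s w = weval A s' w.
Proof.
  destruct w; unfold weval; simpl; intros H.
  - apply (nilpotent3 A L).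
  - auto.
  - f_equal; auto.
Qed.

(** A failure of an entailment in a graph semiring involves one word on the
    right, hence at most two variables there; folding the graph while keeping
    their values (and the common value of the left side) in place turns it into
    a failure in which the variables take boundedly many values. *)
Lemma entails_of_small_entailments (G : graph) (W : algebra -> Prop) m n l q :
  subclass W NF3 -> 0 < m -> closing G m -> 2 + folding_bound m <= n -> l <> [] ->
  (forall e, In e (small_basis W n) -> satisfies (graph_semiring G) e) ->
  (forall A, W A -> entails A l q) -> entails (graph_semiring G) l q.
Proof.
  intros HW Hm Hclose Hn Hl HG Hent. apply entails_graph. intros s v Hv Hw.
  set (L := gs_vertices v ++ flat_map (fun i => gs_vertices (s i)) (word_vars q)).
  assert (Hlen : forall x : gs_elt G, length (gs_vertices x) <= 1)
    by (intros []; simpl; lia).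
  destruct (folding G m L Hm Hclose) as (h & F & Hh & Hfix & HF & HlenF).
  { unfold L. rewrite length_app. assert (H := Hlen v).
    destruct q as [| i | i j]; simpl; rewrite ?length_app; simpl; try lia.
    - specialize (Hlen (s i)). lia.
    - assert (Hi := Hlen (s i)). specialize (Hlen (s j)). lia. }
  assert (Hfix' : forall x, incl (gs_vertices x) L -> gs_map h x = x).
  { intros [x | |] Hx; simpl; trivial. rewrite Hfix; trivial. apply Hx. now left. }
  set (pool := gs_zero :: gs_omega :: map gs_vertex F).
  assert (Hpool : forall x : gs_elt G, In (gs_map h x) pool).
  { intros [x | |]; simpl; auto. right. right. now apply in_map. }
  destruct (constructive_indefinite_description
     (fun r : nat -> nat => forall i, r i < n /\ nth (r i) pool gs_zero = gs_map h (s i)))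
    as [r Hr].
  { exists (fun i => epsilon (inhabits 0) (fun k => k < n /\ nth k pool gs_zero = gs_map h (s i))).
    intros i. apply (epsilon_spec (inhabits 0)
                       (fun k => k < n /\ nth k pool gs_zero = gs_map h (s i))).
    destruct (In_nth pool _ gs_zero (Hpool (s i))) as (k & Hk & E).
    exists k. split; trivial. unfold pool in Hk. simpl in Hk.
    rewrite length_map in Hk. lia. }
  assert (Hshort : forall w, In (word_rename r w) (short_words n)).
  { intros w. apply in_short_words. intros i Hi. destruct w; simpl in Hi;
      intuition; subst; apply Hr. }
  set (s0 := (fun k => nth k pool gs_zero) : nat -> graph_semiring G).
  assert (Es : forall w, weval (graph_semiring G) s0 (word_rename r w) =
                         weval (graph_semiring G) (fun i => gs_map h (s i)) w).
  { intros w. rewrite (weval_rename _ (graph_semiring_laws G)). f_equal.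
    extensionality i. apply Hr. }
  assert (Hsmall : entails (graph_semiring G) (map (word_rename r) l) (word_rename r q)).
  { apply (small_basis_entails W n); trivial.
    - apply graph_semiring_laws.
    - destruct l; [easy | discriminate].
    - intros w [<- | Hin]; trivial. apply in_map_iff in Hin.
      now destruct Hin as (w' & <- & _).
    - intros A HA. apply entails_rename; auto. now apply nf3_laws_of_NF3, HW. }
  assert (Ev : gs_map h v = v) by (apply Hfix'; intros x Hx; apply in_or_app; auto).
  rewrite (weval_ext _ (graph_semiring_laws G) s (fun i => gs_map h (s i))).
  - rewrite <- Es. apply (proj1 (entails_graph _ _ _) Hsmall); trivial.
    intros w Hin. apply in_map_iff in Hin. destruct Hin as (w' & <- & Hin).
    rewrite Es, (weval_gs_map G h s w' v); auto.
  - intros i Hi. symmetry. apply Hfix'. intros x Hx. apply in_or_app. right.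
    apply in_flat_map. now exists i.
Qed.

(** The bound on the number of variables leaves room for the entailment that
    closes all walks of length [m], so that this one is in the basis as well and
    makes the foldings available. *)
Theorem finitely_based_of_not_above_V_ac (W : algebra -> Prop) :
  is_variety W -> subclass W NF3 -> ~ subclass V_ac W -> finitely_based W.
Proof.
  intros HW HWN Hnot.
  destruct (bounded_paths W HW Hnot) as [b Hb].
  assert (Hpath : forall G, W (graph_semiring G) -> ~ has_path G (S b)).
  { intros G HG (c & Hc & Hinj). apply (Hb G HG). exists c.
    split; intros; [apply Hc | apply Hinj]; trivial; lia. }
  set (m := fact (S b)). assert (Hm : 0 < m) by apply lt_O_fact.
  assert (Hwalk : walk_words m <> []).
  { intros E. apply (f_equal (@length word)) in E. unfold walk_words in E.
    rewrite length_map, length_seq in E. apply (Nat.neq_0_lt_0 m); trivial. }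
  set (n := 2 + folding_bound m + S m).
  exists (small_basis W n). intros A. split.
  - intros HA e He. apply in_app_or in He. destruct He as [He | He].
    + revert e He. apply nf3_basis_correct. now apply nf3_laws_of_NF3, HWN.
    + apply filter_In in He. destruct He as [_ He]. now apply (proj1 (truth_true _) He).
  - intros HA.
    assert (LA : nf3_laws A).
    { apply nf3_basis_correct. intros e He. apply HA, in_or_app. now left. }
    apply birkhoff; trivial. intros [t u] Htu.
    apply satisfies_of_graph_quotients; trivial. intros G (f & Hf & Hsurj).
    assert (HG : forall e, In e (small_basis W n) -> satisfies (graph_semiring G) e).
    { intros e He. apply (satisfies_quotient A _ f); auto. }
    assert (Hclose : closing G m).
    { apply closing_of_entails; trivial.
      apply (small_basis_entails W n); trivial.
      - apply graph_semiring_laws.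
      - intros w Hw. apply in_short_words. intros i Hi.
        destruct Hw as [<- | Hw].
        + simpl in Hi. unfold n. lia.
        + apply in_map_iff in Hw. destruct Hw as (k & <- & Hk). apply in_seq in Hk.
          simpl in Hi. unfold n. lia.
      - intros B HB. apply entails_of_graph_quotients; trivial.
        + now apply nf3_laws_of_NF3, HWN.
        + intros H (g & Hg & Hgsurj). apply entails_of_bounded_paths, Hpath.
          exact (proj1 HW B _ g Hg Hgsurj HB). }
    assert (Hent : forall B, W B ->
        (forall q, In q (words u) -> entails B (words t) q) /\
        (forall q, In q (words t) -> entails B (words u) q)).
    { intros B HB. apply satisfies_entails; [now apply nf3_laws_of_NF3, HWN |].
      now apply Htu. }
    apply (satisfies_entails _ (graph_semiring_laws G)).
    split; intros q Hq; apply (entails_of_small_entailments G W m n); trivial;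
      try (unfold n; lia); try apply words_nonempty; intros B HB; now apply (Hent B HB).
Qed.

Theorem theorem4p13 :
  (limit_variety V_ac /\ subclass V_ac NF3) /\
  (forall V : algebra -> Prop,
     limit_variety V -> subclass V NF3 -> same_class V V_ac).
Proof.
  split; [split; [split; [| split] |] |].
  - apply is_variety_generated.
  - apply V_ac_not_finitely_based.
  - intros W HW Hsub Hne. apply finitely_based_of_not_above_V_ac; trivial.
    + intros A HA. now apply V_ac_NF3, Hsub.
    + intros Hsup. apply Hne. intros A. split; auto.
  - apply V_ac_NF3.
  - intros V (HV & Hnfb & Hmin) HVN.
    assert (Hsup : subclass V_ac V).
    { apply Classical_Prop.NNPP. intros H. apply Hnfb.
      now apply finitely_based_of_not_above_V_ac. }
    apply Classical_Prop.NNPP. intros Hne. apply V_ac_not_finitely_based.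
    apply Hmin; trivial; [apply is_variety_generated |].
    intros Hsame. apply Hne. intros A. split; apply Hsame.
Qed.
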